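(* Let $N\ge 2$, let $L$ be the $N\times N$ Jacobi matrix of the Toda lattice in Flaschka coordinates $(a_1,\dots,a_{N-1},b_1,\dots,b_N)$, let $\pi_1,\pi_2,\pi_3,\dots$ be the Toda hierarchy of Poisson tensors in these coordinates, and let $Y_j=D(\pi_j)$ be the modular vector field of $\pi_j$. Put $f=\ln(a_1\cdots a_{N-1})$ and $g=\ln(\det L)$. Then for every integer $j\ge1$, on the open set where all $a_i>0$ and $\det L>0$, $$Y_j=\mathcal{X}^{\pi_j}_{f+(j-1)g}.$$
   Context: Coordinates on $\mathbb{R}^{2N-1}$: $(x_1,\dots,x_{2N-1})=(a_1,\dots,a_{N-1},b_1,\dots,b_N)$, with the convention $a_0=a_N=0$ (and terms containing variables of index outside the allowed range are zero). $L$ is the symmetric tridiagonal matrix with $L_{ii}=b_i$, $L_{i,i+1}=L_{i+1,i}=a_i$, and other entries zero. A Poisson tensor $\pi$ is identified with its matrix $\pi_{ik}=\{x_i,x_k\}_\pi$. The Hamiltonian vector field of a function $h$ is $\mathcal{X}_h^{\pi}=\pi\nabla h$, i.e. its $x_i$-component is $\{x_i,h\}_\pi$. The modular vector field (with respect to the standard volume) of $\pi$ is $$D(\pi)=\sum_{k}\Big(\sum_{i}\frac{\partial\pi_{ki}}{\partial x_i}\Big)\frac{\partial}{\partial x_k}.$$ The Toda hierarchy $\pi_j$: - $\pi_1$ is given by $\{a_i,b_i\}=-a_i$, $\{a_i,b_{i+1}\}=a_i$ ($1\le i\le N-1$), all other brackets of coordinates zero. - $\pi_2$ is given by $\{a_i,a_{i+1}\}=\tfrac12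 a_ia_{i+1}$, $\{a_i,b_i\}=-a_ib_i$, $\{a_i,b_{i+1}\}=a_ib_{i+1}$, $\{b_i,b_{i+1}\}=2a_i^2$, all other brackets zero. - The higher tensors are obtained by Lie derivatives along master symmetries $X_1,X_2$: $\pi_3=-\mathcal{L}_{X_1}\pi_2$, $\pi_4=-\tfrac12\mathcal{L}_{X_2}\pi_2$, and $\pi_{j+1}=\tfrac{1}{j-3}\mathcal{L}_{X_1}\pi_j$ for $j\ge4$ (instances of the known relations $\mathcal{L}_{X_i}\pi_j=(j-i-2)\pi_{i+j}$). Here $X_1=\sum_{i=1}^{N-1}A_i\frac{\partial}{\partial a_i}+\sum_{i=1}^NB_i\frac{\partial}{\partial b_i}$ with $$A_i=-i\,a_ib_i+(i+2)a_ib_{i+1},\qquad B_i=(2i+3)a_i^2+(1-2i)a_{i-1}^2+b_i^2,$$ and $X_2=\sum_{i=1}^{N-1}C_i\frac{\partial}{\partial a_i}+\sum_{i=1}^ND_i\frac{\partial}{\partial b_i}$ with $$C_i=(2-i)a_{i-1}^2a_i+(1-i)a_ib_i^2+a_ib_ib_{i+1}+(i+1)a_ia_{i+1}^2+(i+1)a_ib_{i+1}^2+a_i^3+\Big(\sum_{k=1}^{i-1}b_k\Big)a_i(b_{i+1}-b_i),$$ $$D_i=2\Big(\sum_{k=1}^{i-1}b_k\Big)a_i^2-2\Big(\sum_{k=1}^{i-2}b_k\Big)a_{i-1}^2+(2i+2)a_i^2b_i+(2i+1)a_i^2b_{i+1}+(3-2i)a_{i-1}^2b_{i-1}+(4-2i)a_{i-1}^2b_i+b_i^3.$$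 *)

(* Defs.v *)
From HB Require Import structures.
From mathcomp Require Import all_boot all_order all_algebra.
From mathcomp Require Import all_classical all_reals all_analysis.

Set Implicit Arguments.
Unset Strict Implicit.
Unset Printing Implicit Defensive.

Import Order.TTheory GRing.Theory Num.Theory.
Import numFieldNormedType.Exports.

Local Open Scope ring_scope.

Section Calculus.
Variables (R : realType) (n : nat).
Implicit Types (h : 'rV[R]_n -> R) (X : 'rV[R]_n -> 'rV[R]_n)
  (P : 'rV[R]_n -> 'M[R]_n) (x : 'rV[R]_n).

Definition pderiv (k : 'I_n) h x : R :=
  'D_(delta_mx 0 k : 'rV[R]_n) (h : 'rV[R]_n -> R^o) x.

Definition gradient h x : 'cV[R]_n := \col_k pderiv k h x.

(* Bivector fields are represented by their matrices
   [P x i k = {x_i, x_k}], vector fields by rows of components. *)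
Definition hamiltonian_field P h x : 'rV[R]_n := (P x *m gradient h x)^T.

(* Taken with respect to the standard volume. *)
Definition modular_field P x : 'rV[R]_n :=
  \row_k \sum_i pderiv i (fun y => P y k i) x.

Definition lie_derivative X P x : 'M[R]_n :=
  \matrix_(i, j) \sum_k
    (X x 0 k * pderiv k (fun y => P y i j) x
     - P x k j * pderiv k (fun y => X y 0 i) x
     - P x i k * pderiv k (fun y => X y 0 j) x).

End Calculus.

Section Toda.
Variables (R : realType) (N : nat).

(* Points are [(a_1, ..., a_(N-1), b_1, ..., b_N)]. *)
Local Notation point := 'rV[R]_(N.-1 + N).
Implicit Types (i k : nat) (x : point).

(* [i] is the 1-based index; out-of-range coordinates are 0, in particular
   [a_0 = a_N = 0]. *)
Definition acoord i x : R :=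
  if i is i'.+1 then oapp (fun k : 'I_N.-1 => x 0 (lshift N k)) 0 (insub i')
  else 0.

Definition bcoord i x : R :=
  if i is i'.+1 then oapp (fun k : 'I_N => x 0 (rshift N.-1 k)) 0 (insub i')
  else 0.

(* In all the matrices and rows below the ordinal [i] stands for the 1-based
   index [i.+1]. *)
Definition jacobi_mx x : 'M[R]_N :=
  \matrix_(i, k)
    if i == k then bcoord i.+1 x
    else if k == i.+1 :> nat then acoord i.+1 x
    else if i == k.+1 :> nat then acoord k.+1 x
    else 0.

Definition pi1_ab x : 'M[R]_(N.-1, N) :=
  \matrix_(i, k)
    if k == i :> nat then - acoord i.+1 x
    else if k == i.+1 :> nat then acoord i.+1 x
    else 0.

Definition pi1 x : 'M[R]_(N.-1 + N) :=
  block_mx 0 (pi1_ab x) (- (pi1_ab x)^T) 0.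

Definition pi2_aa x : 'M[R]_N.-1 :=
  \matrix_(i, k)
    if k == i.+1 :> nat then 2^-1 * acoord i.+1 x * acoord k.+1 x
    else if i == k.+1 :> nat then - (2^-1 * acoord k.+1 x * acoord i.+1 x)
    else 0.

Definition pi2_ab x : 'M[R]_(N.-1, N) :=
  \matrix_(i, k)
    if k == i :> nat then - (acoord i.+1 x * bcoord i.+1 x)
    else if k == i.+1 :> nat then acoord i.+1 x * bcoord i.+2 x
    else 0.

Definition pi2_bb x : 'M[R]_N :=
  \matrix_(i, k)
    if k == i.+1 :> nat then 2 * acoord i.+1 x ^+ 2
    else if i == k.+1 :> nat then - (2 * acoord k.+1 x ^+ 2)
    else 0.

Definition pi2 x : 'M[R]_(N.-1 + N) :=
  block_mx (pi2_aa x) (pi2_ab x) (- (pi2_ab x)^T) (pi2_bb x).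

(* Components of the master symmetries; the coefficients may be negative, hence
   the casts to [R]. *)
Definition X1_a i x : R :=
  - i%:R * acoord i x * bcoord i x + (i%:R + 2) * acoord i x * bcoord i.+1 x.

Definition X1_b i x : R :=
  (2 * i%:R + 3) * acoord i x ^+ 2 + (1 - 2 * i%:R) * acoord i.-1 x ^+ 2
  + bcoord i x ^+ 2.

Definition X1 x : point :=
  row_mx (\row_(i < N.-1) X1_a i.+1 x) (\row_(i < N) X1_b i.+1 x).

Definition X2_a i x : R :=
  (2 - i%:R) * acoord i.-1 x ^+ 2 * acoord i x
  + (1 - i%:R) * acoord i x * bcoord i x ^+ 2
  + acoord i x * bcoord i x * bcoord i.+1 x
  + (i%:R + 1) * acoord i x * acoord i.+1 x ^+ 2
  + (i%:R + 1) * acoord i x * bcoord i.+1 x ^+ 2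
  + acoord i x ^+ 3
  + (\sum_(1 <= k < i) bcoord k x) * acoord i x
    * (bcoord i.+1 x - bcoord i x).

Definition X2_b i x : R :=
  2 * (\sum_(1 <= k < i) bcoord k x) * acoord i x ^+ 2
  - 2 * (\sum_(1 <= k < i.-1) bcoord k x) * acoord i.-1 x ^+ 2
  + (2 * i%:R + 2) * acoord i x ^+ 2 * bcoord i x
  + (2 * i%:R + 1) * acoord i x ^+ 2 * bcoord i.+1 x
  + (3 - 2 * i%:R) * acoord i.-1 x ^+ 2 * bcoord i.-1 x
  + (4 - 2 * i%:R) * acoord i.-1 x ^+ 2 * bcoord i x
  + bcoord i x ^+ 3.

Definition X2 x : point :=
  row_mx (\row_(i < N.-1) X2_a i.+1 x) (\row_(i < N) X2_b i.+1 x).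

(* The hierarchy starts at [j = 1]; the value at 0 is a placeholder. *)
Fixpoint toda_tensor (j : nat) : point -> 'M[R]_(N.-1 + N) :=
  match j with
  | 0 => fun=> 0
  | 1 => pi1
  | 2 => pi2
  | 3 => fun x => - lie_derivative X1 pi2 x
  | 4 => fun x => - (2^-1 *: lie_derivative X2 pi2 x)
  | j'.+1 =>
      fun x => (j'%:R - 3)^-1 *: lie_derivative X1 (toda_tensor j') x
  end.

Definition log_prod_a x : R := ln (\prod_(1 <= i < N) acoord i x).

Definition log_det_L x : R := ln (\det (jacobi_mx x)).

End Toda.

(* Main.v *)
Require Import Defs.
From HB Require Import structures.
From mathcomp Require Import all_boot all_order all_algebra.
From mathcomp Require Import all_classical all_reals all_analysis.
From mathcomp Require Import zify ring.
From mathcomp Require mpoly.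
Set Implicit Arguments.
Unset Strict Implicit.
Unset Printing Implicit Defensive.
Import Order.TTheory GRing.Theory Num.Theory.
Import numFieldNormedType.Exports.
Local Open Scope ring_scope.

(** The entries of the Toda tensors are polynomials in the Flaschka coordinates, so
everything except the two logarithms takes place in a differential ring [A]: an
integral domain with commuting derivations [d k] and coordinates [x k]. At the end [A]
is the ring of polynomials, evaluated at the given point. Below, [P # h] stands for
the Hamiltonian field [sharp d P h], and [H_k] for [\tr (L ^+ k) / k].

Three facts propagate along the hierarchy.

Lie derivatives: [[X, P # h] = (L_X P) # h + P # (X h)] ([lie_vf_sharp]), and
[curl (L_X P) = [X, curl P] - P # (div X)] ([curl_lie]).

Master symmetries move the spectrum: the Lax equations [X1 L = [B, L] + L ^+ 2] and
[X2 L = [C, L] + L ^+ 3] ([lax_X1], [lax_X2]) give [X1 H_k = (k + 1) H_(k+1)] and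
[X2 H_k = (k + 2) H_(k+2)].

Lenard relations: [pi_(j+1) # H_k = pi_j # H_(k+1)] for all positive [j] and [k]
([lenard_hierarchy]). For [j = 1] this is a computation with symmetric matrices that
commute with [L] ([lenard_pi12]); taking Lie derivatives along the master symmetries
gives the other ones ([lenard_lie]). The identities between tensors that enter are
[L_X1 pi_1 = - 2 pi_2] and [L_X2 pi_1 = 3 L_X1 pi_2]; the later Lie derivatives are
only evaluated on differentials of the [H_k].

Writing [f] for the logarithm of the product of the [a_i], one gets by induction
[curl pi_j = pi_j # f + (j - 1) pi_(j-1) # (\tr L)] ([modular_hierarchy]): the
base cases are direct, and the inductive step rests on
[X1 f - div X1 = - 2 \tr L] and [X2 f - div X2 = - 3 \tr (L ^+ 2)] ([div_X1],
[div_X2]). As [f] is not in [A], the identity is multiplied by the product of the [a_i].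

It remains to see that [pi_(j-1) # (\tr L) = pi_j # (\ln (\det L))], the Lenard
relation for [H_0] ([lenard_det]). It follows from those for positive [k]: by Jacobi's
formula the differential of [\det L] is given by the adjugate of [L], which by
Cayley-Hamilton is a combination of powers of [L]. *)

(** * Derivations of a commutative ring *)

Record derivation (A : comNzRingType) (D : A -> A) : Prop := Derivation {
  derD : {morph D : u v / u + v};
  derM : forall u v, D (u * v) = D u * v + u * D v }.

Section Derivation.
Variables (A : comNzRingType) (D : A -> A) (dD : derivation D).

Lemma der0 : D 0 = 0.
Proof. by apply: (addrI (D 0)); rewrite -(derD dD) !addr0. Qed.

Lemma der1 : D 1 = 0.
Proof.
apply: (addrI (D 1)); rewrite addr0.
by rewrite -[RHS](congr1 D (mulr1 1)) (derM dD) mulr1 mul1r.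
Qed.

Lemma derN u : D (- u) = - D u.
Proof. by apply: (addrI (D u)); rewrite -(derD dD) !subrr der0. Qed.

Lemma derB u v : D (u - v) = D u - D v.
Proof. by rewrite (derD dD) derN. Qed.

Lemma der_nat m : D m%:R = 0.
Proof.
by elim: m => [|m IHm]; rewrite ?der0// -addn1 natrD (derD dD) IHm der1 addr0.
Qed.

Lemma der_natM m u : D (m%:R * u) = m%:R * D u.
Proof. by rewrite (derM dD) der_nat mul0r add0r. Qed.

Lemma der_sign m : D ((-1) ^+ m) = 0.
Proof.
elim: m => [|m IHm]; first by rewrite expr0 der1.
by rewrite exprS (derM dD) IHm derN der1 oppr0 mul0r mulr0 addr0.
Qed.

Lemma derX u m :
  D (u ^+ m.+1) = m.+1%:R * u ^+ m * D u.
Proof.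
elim: m => [|m IHm]; first by rewrite expr1; ring.
by rewrite exprS (derM dD) IHm -natr1 exprS; ring.
Qed.

Lemma der_sum I (r : seq I) (P : pred I) F :
  D (\sum_(i <- r | P i) F i) = \sum_(i <- r | P i) D (F i).
Proof. exact: (big_morph D (derD dD) der0). Qed.

(** A derivation acts on a product of eigenvectors through its logarithmic
derivative; this replaces the logarithm of a product, which is not a ring element. *)
Lemma der_prod_log I (r : seq I) (F phi : I -> A) :
    (forall i, D (F i) = F i * phi i) ->
  D (\prod_(i <- r) F i) = \prod_(i <- r) F i * \sum_(i <- r) phi i.
Proof.
move=> DF; elim: r => [|i r IHr]; first by rewrite !big_nil der1 mulr0.
by rewrite !big_cons (derM dD) DF IHr; ring.
Qed.

Lemma der_prod (I : finType) (F : I -> A) :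
  D (\prod_i F i) = \sum_i D (F i) * \prod_(l | l != i) F l.
Proof.
suff gen (r : seq I) : uniq r ->
    D (\prod_(i <- r) F i) = \sum_(i <- r) D (F i) * \prod_(l <- r | l != i) F l.
  by rewrite gen ?index_enum_uniq//; apply: eq_bigr.
elim: r => [|i r IHr]; first by rewrite !big_nil der1.
case/andP=> ir ur; rewrite big_cons (derM dD) IHr// big_cons.
congr (_ + _).
  rewrite big_cons eqxx; congr (_ * _).
  rewrite [RHS]big_seq_cond [LHS]big_seq_cond; apply: eq_bigl => l.
  by rewrite andbT; case: (boolP (l \in r)) => //= lr; apply/esym; apply: contraNneq ir => <-.
rewrite mulr_sumr; apply: eq_big_seq => l lr.
rewrite big_cons ifT; first by rewrite mulrCA.
by apply: contraNneq ir => ->.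
Qed.

Lemma map_mx_derM m p q (M : 'M[A]_(m, p)) (Q : 'M[A]_(p, q)) :
  map_mx D (M *m Q) = map_mx D M *m Q + M *m map_mx D Q.
Proof.
apply/matrixP=> i k; rewrite !mxE der_sum -big_split.
by apply: eq_bigr => l _; rewrite (derM dD) !mxE.
Qed.

Lemma der_mxtrace m (M : 'M[A]_m) : D (\tr M) = \tr (map_mx D M).
Proof. by rewrite der_sum; apply: eq_bigr => i _; rewrite mxE. Qed.

(** Cyclicity of the trace lets the factor [map_mx D M], wherever the Leibniz rule
puts it, be moved to the end. *)
Lemma der_mxtraceX m (M : 'M[A]_m) k :
  D (\tr (M ^+ k.+1)) = k.+1%:R * \tr (M ^+ k *m map_mx D M).
Proof.
suff gen l : \tr (M ^+ l *m map_mx D (M ^+ k.+1)) =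
    k.+1%:R * \tr (M ^+ (l + k) *m map_mx D M).
  by rewrite der_mxtrace -[map_mx D _]mul1mx -(gen 0%N) expr0.
elim: k l => [|k IHk] l; first by rewrite expr1 addn0 mul1r.
rewrite exprS -mulmxE map_mx_derM mulmxDr mxtraceD.
have -> : M ^+ l *m (M *m map_mx D (M ^+ k.+1)) =
    M ^+ l.+1 *m map_mx D (M ^+ k.+1) by rewrite mulmxA !mulmxE -exprSr.
rewrite IHk mulmxA mxtrace_mulC mulmxA !mulmxE -exprD addnC addSnnS.
by rewrite -[in RHS]natr1 mulrDl mul1r addrC.
Qed.

(** Jacobi's formula. By the Leibniz rule the derivative is a sum of determinants
with one row differentiated; expanding along that row gives the cofactors of [M]. *)
Lemma der_det m (M : 'M[A]_m) :
  D (\det M) = \tr (\adj M *m map_mx D M).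
Proof.
have -> : D (\det M) = \sum_i \det (\matrix_(l, k) if l == i then D (M l k) else M l k).
  rewrite /determinant der_sum exchange_big; apply: eq_bigr => s _ /=.
  rewrite (derM dD) [D (_ ^+ _)](_ : _ = 0) ?mul0r ?add0r.
    rewrite der_prod mulr_sumr; apply: eq_bigr => i _; congr (_ * _).
    rewrite [RHS](bigD1 i)//= mxE eqxx; congr (_ * _).
    by apply: eq_bigr => l li; rewrite mxE (negPf li).
  exact: der_sign.
rewrite mxtrace_mulC; apply: eq_bigr => i _.
rewrite (expand_det_row _ i) mxE; apply: eq_bigr => k _.
rewrite !mxE eqxx; congr (_ * (_ * \det _)).
by apply/matrixP=> u v; rewrite !mxE eq_sym (negPf (neq_lift _ _)).
Qed.

End Derivation.

(** * Vector fields and bivector fields over a differential ring *)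

Section DifferentialRing.
Variables (A : comNzRingType) (n : nat) (d : 'I_n -> A -> A).
Hypothesis (dd : forall k, derivation (d k)).
Hypothesis (dC : forall i k u, d i (d k u) = d k (d i u)).
Implicit Types (X Y : 'rV[A]_n) (P : 'M[A]_n) (u v h : A).

Definition vf_app X h := \sum_k X 0 k * d k h.
Definition lie_vf X Y : 'rV[A]_n :=
  \row_i (vf_app X (Y 0 i) - vf_app Y (X 0 i)).
(** Hamiltonian vector field of [h] for the bivector [P], as in [hamiltonian_field]. *)
Definition sharp P h : 'rV[A]_n := \row_i \sum_k P i k * d k h.
Definition lie_bv X P : 'M[A]_n :=
  \matrix_(i, j) \sum_k
    (X 0 k * d k (P i j) - P k j * d k (X 0 i) - P i k * d k (X 0 j)).
(** Modular vector field of [P] for the standard volume, as in [modular_field]. *)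
Definition curl P : 'rV[A]_n := \row_k \sum_i d i (P k i).
Definition divergence X := \sum_k d k (X 0 k).
Definition bracket P u v := vf_app (sharp P v) u.

Lemma vf_app_der X : derivation (vf_app X).
Proof.
split=> u v; rewrite /vf_app.
  by rewrite -big_split; apply: eq_bigr => k _; rewrite (derD (dd k)) mulrDr.
rewrite mulr_suml mulr_sumr -big_split; apply: eq_bigr => k _.
by rewrite (derM (dd k)) /=; ring.
Qed.

Lemma vf_appDl X Y h : vf_app (X + Y) h = vf_app X h + vf_app Y h.
Proof. by rewrite -big_split; apply: eq_bigr => k _; rewrite mxE mulrDl. Qed.

Lemma vf_appZl f X h : vf_app (f *: X) h = f * vf_app X h.
Proof. by rewrite mulr_sumr; apply: eq_bigr => k _; rewrite mxE mulrA. Qed.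

Lemma sharpD P u v : sharp P (u + v) = sharp P u + sharp P v.
Proof.
apply/rowP=> i; rewrite !mxE -big_split; apply: eq_bigr => k _.
by rewrite (derD (dd k)) mulrDr.
Qed.

Lemma sharpM P u v : sharp P (u * v) = u *: sharp P v + v *: sharp P u.
Proof.
apply/rowP=> i; rewrite !mxE !mulr_sumr -big_split; apply: eq_bigr => k _.
by rewrite (derM (dd k)) /=; ring.
Qed.

Lemma sharpN P u : sharp P (- u) = - sharp P u.
Proof.
apply/rowP=> i; rewrite !mxE -sumrN; apply: eq_bigr => k _.
by rewrite (derN (dd k)) mulrN.
Qed.

Lemma sharp_natM P m h : sharp P (m%:R * h) = m%:R *: sharp P h.
Proof.
apply/rowP=> i; rewrite !mxE !mulr_sumr; apply: eq_bigr => k _.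
by rewrite (der_natM (dd k)) mulrCA.
Qed.

Lemma sharpZl c P h : sharp (c *: P) h = c *: sharp P h.
Proof.
apply/rowP=> i; rewrite !mxE !mulr_sumr; apply: eq_bigr => k _.
by rewrite mxE mulrA.
Qed.

Lemma lie_vfZr X f Y : lie_vf X (f *: Y) = vf_app X f *: Y + f *: lie_vf X Y.
Proof.
apply/rowP=> i; rewrite !mxE (derM (vf_app_der X)) vf_appZl; ring.
Qed.

Lemma lie_vfDr X Y Z : lie_vf X (Y + Z) = lie_vf X Y + lie_vf X Z.
Proof.
apply/rowP=> i; rewrite !mxE (derD (vf_app_der X)) vf_appDl; ring.
Qed.

Lemma vf_app_lie X Y u :
  vf_app (lie_vf X Y) u = vf_app X (vf_app Y u) - vf_app Y (vf_app X u).
Proof.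
rewrite [X in X - _](der_sum (vf_app_der X)).
rewrite [X in _ - X](der_sum (vf_app_der Y)).
under [X in X - _]eq_bigr do rewrite (derM (vf_app_der X)).
under [X in _ - X]eq_bigr do rewrite (derM (vf_app_der Y)).
rewrite !big_split /=.
have -> : \sum_i Y 0 i * vf_app X (d i u) = \sum_i X 0 i * vf_app Y (d i u).
  under eq_bigr do rewrite mulr_sumr.
  under [RHS]eq_bigr do rewrite mulr_sumr.
  rewrite exchange_big; apply: eq_bigr => k _; apply: eq_bigr => i _.
  by rewrite dC; ring.
rewrite opprD addrACA subrr addr0 -sumrB; apply: eq_bigr => k _.
by rewrite mxE mulrBl.
Qed.

(** The Leibniz rule for the contraction of a bivector with an exact form: the Lie
derivative commutes with the differential, so only [d h] becomes [d (X h)]. *)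
Lemma lie_vf_sharp X P h :
  lie_vf X (sharp P h) = sharp (lie_bv X P) h + sharp P (vf_app X h).
Proof.
apply/rowP=> i; rewrite !mxE (der_sum (vf_app_der X)).
under eq_bigr do rewrite (derM (vf_app_der X)).
rewrite big_split /=.
have -> : \sum_k P i k * d k (vf_app X h) =
    \sum_k P i k * vf_app X (d k h)
    + \sum_k \sum_l P i l * d l (X 0 k) * d k h.
  rewrite exchange_big -big_split; apply: eq_bigr => k _ /=.
  rewrite [d k _](der_sum (dd k)) !mulr_sumr -big_split /=.
  by apply: eq_bigr => l _; rewrite (derM (dd k)) dC; ring.
have -> : vf_app (sharp P h) (X 0 i) = \sum_k \sum_l P l k * d l (X 0 i) * d k h.
  rewrite exchange_big; apply: eq_bigr => l _; rewrite mxE mulr_suml.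
  by apply: eq_bigr => k _; ring.
have -> : \sum_k lie_bv X P i k * d k h = \sum_k vf_app X (P i k) * d k h
    - \sum_k \sum_l P l k * d l (X 0 i) * d k h
    - \sum_k \sum_l P i l * d l (X 0 k) * d k h.
  rewrite -!sumrB; apply: eq_bigr => k _.
  by rewrite mxE !sumrB !mulrBl !mulr_suml.
ring.
Qed.

(** Reads the Lie derivative of a tensor off brackets of functions, so that it can be
computed on coordinates with the Leibniz rule alone. *)
Lemma bracket_lie X P u v : bracket (lie_bv X P) u v =
  vf_app X (bracket P u v) - bracket P (vf_app X u) v - bracket P u (vf_app X v).
Proof.
by rewrite /bracket -vf_app_lie lie_vf_sharp vf_appDl addrK.
Qed.

Lemma bracket_derl P v : derivation (bracket P ^~ v).
Proof. exact: vf_app_der. Qed.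

Lemma bracket_derr P u : derivation (bracket P u).
Proof.
split=> v w; rewrite /bracket ?sharpD ?sharpM !vf_appDl ?vf_appZl//.
by rewrite addrC mulrC.
Qed.

Lemma bracketZ c P u v : bracket (c *: P) u v = c * bracket P u v.
Proof. by rewrite /bracket sharpZl vf_appZl. Qed.

Lemma bracketE P u v : bracket P u v = \sum_i \sum_k P i k * d i u * d k v.
Proof.
apply: eq_bigr => i _; rewrite mxE mulr_suml.
by apply: eq_bigr => k _; ring.
Qed.

Lemma asym_mxE P : P^T = - P -> forall i k, P i k = - P k i.
Proof. by move=> /matrixP Pa i k; have := Pa k i; rewrite !mxE. Qed.

Lemma bracket_asym P : P^T = - P -> forall u v, bracket P u v = - bracket P v u.
Proof.
move=> Pa u v; rewrite !bracketE exchange_big -sumrN; apply: eq_bigr => i _.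
rewrite -sumrN; apply: eq_bigr => k _.
by rewrite (asym_mxE Pa k i); ring.
Qed.

Lemma lie_bv_asym X P : P^T = - P -> (lie_bv X P)^T = - lie_bv X P.
Proof.
move=> Pa; apply/matrixP=> i j; rewrite !mxE -sumrN; apply: eq_bigr => k _.
have Ps := asym_mxE Pa.
by rewrite (Ps j i) (derN (dd k)) (Ps k i) (Ps j k); ring.
Qed.

Lemma curl_natZ m Q : curl (m%:R *: Q) = m%:R *: curl Q.
Proof.
apply/rowP=> k; rewrite !mxE mulr_sumr; apply: eq_bigr => i _.
by rewrite mxE (der_natM (dd i)).
Qed.

Lemma curlN Q : curl (- Q) = - curl Q.
Proof.
apply/rowP=> k; rewrite !mxE -sumrN; apply: eq_bigr => i _.
by rewrite mxE (derN (dd i)).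
Qed.

(** A flow changes the modular field by transport and by the Hamiltonian field of
the divergence, because it changes the reference volume at the rate [div X]. In
coordinates the only second derivatives left over contract the antisymmetric [P]
with the symmetric Hessian of a component of [X]. *)
Lemma curl_lie X P : (forall u : A, u + u = 0 -> u = 0) -> P^T = - P ->
  curl (lie_bv X P) = lie_vf X (curl P) - sharp P (divergence X).
Proof.
move=> reg2 Pa; apply/rowP=> k; rewrite !mxE.
have Ps := asym_mxE Pa.
(* The second derivatives of [X] contracted with the antisymmetric [P]. *)
have mixed0 : \sum_i \sum_l P l i * d i (d l (X 0 k)) = 0.
  apply: reg2; rewrite {1}exchange_big -big_split big1// => i _.
  rewrite -big_split big1// => l _ /=.
  by rewrite (Ps l i) dC; ring.
have -> : vf_app X (\sum_i d i (P k i)) =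
    \sum_i \sum_l X 0 l * d i (d l (P k i)).
  rewrite (der_sum (vf_app_der X)); apply: eq_bigr => i _.
  by apply: eq_bigr => l _; rewrite dC.
have -> : vf_app (curl P) (X 0 k) = \sum_i \sum_l d i (P l i) * d l (X 0 k).
  rewrite exchange_big; apply: eq_bigr => l _.
  by rewrite mxE mulr_suml.
have -> : \sum_k0 P k k0 * d k0 (divergence X) =
    \sum_i \sum_l P k l * d i (d l (X 0 i)).
  rewrite exchange_big; apply: eq_bigr => l _; rewrite (der_sum (dd l)) mulr_sumr.
  by apply: eq_bigr => i _; rewrite dC.
(* Two terms with first derivatives of both [P] and [X] differ by a renaming. *)
have swap : \sum_i \sum_l d i (P k l) * d l (X 0 i) =
            \sum_i \sum_l d i (X 0 l) * d l (P k i).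
  by rewrite exchange_big; apply: eq_bigr => i _; apply: eq_bigr => l _; ring.
rewrite -[LHS]addr0 -[X in _ + X = _]mixed0.
rewrite [RHS](_ : _ = \sum_i \sum_l X 0 l * d i (d l (P k i))
  - \sum_i \sum_l d i (P l i) * d l (X 0 k)
  - \sum_i \sum_l P k l * d i (d l (X 0 i))
  + (\sum_i \sum_l d i (X 0 l) * d l (P k i)
     - \sum_i \sum_l d i (P k l) * d l (X 0 i))); last first.
  by rewrite swap subrr addr0.
rewrite -!sumrB -!big_split /=; apply: eq_bigr => i _.
rewrite mxE (der_sum (dd i)) -!sumrB -!big_split /=; apply: eq_bigr => l _.
rewrite !(derB (dd i)) !(derM (dd i)); ring.
Qed.

End DifferentialRing.

(** * Matrices and finite sums *)

(** Cayley-Hamilton gives [r(M) M = - c] where [r X + c] is the characteristic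
polynomial; multiplying by the adjugate turns this into a multiple of
[\det M *: \adj M]. *)
Lemma adj_poly_mx (K : idomainType) m (M : 'M[K]_m) : \det M != 0 ->
  exists q : {poly K}, \adj M = \sum_(i < size q) q`_i *: M ^+ i.
Proof.
case: m M => [|m] M detM; first by exists 0; apply/matrixP=> -[].
suff [q ->] : exists q : {poly K}, \adj M = horner_mx M q.
  exists q; rewrite -[X in horner_mx M X]coefK poly_def linear_sum.
  by apply: eq_bigr => i _; rewrite linearZ rmorphXn /= horner_mx_X.
have [r [c rc]] : exists r c, char_poly M = r * 'X + c%:P.
  elim/poly_ind: (char_poly M) => [|r c _]; last by exists r, c.
  by exists 0, 0; rewrite mul0r addr0.
have cE : c = (-1) ^+ m.+1 * \det M.
  by rewrite -char_poly_det rc coefD coefMX coefC /= add0r.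
have /(congr1 (fun B => B *m \adj M)) := Cayley_Hamilton M.
rewrite rc rmorphD rmorphM /= horner_mx_X horner_mx_C mul0mx mulmxDl.
rewrite -mulmxA mul_mx_adj mul_mx_scalar mul_scalar_mx cE -scalerA.
move=> /eqP; rewrite addr_eq0 => /eqP E.
exists ((-1) ^+ m *: r); rewrite linearZ /=.
apply/matrixP=> i k; apply: (mulfI detM).
move/matrixP/(_ i k): E; rewrite !mxE => E.
by rewrite [RHS]mulrCA E exprS mulN1r mulNr opprK signrMK.
Qed.

(** Entry rules that, unlike [mxE], leave the matrices [M] themselves folded. *)
Section MatrixEntries.
Variables (A : pzRingType) (p q : nat) (i : 'I_p) (k : 'I_q).
Implicit Types M : 'M[A]_(p, q).

Lemma mxZE c M : (c *: M) i k = c * M i k.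
Proof. by rewrite mxE. Qed.

Lemma mxDE M1 M2 : (M1 + M2) i k = M1 i k + M2 i k.
Proof. by rewrite mxE. Qed.

Lemma mxNE M : (- M) i k = - M i k.
Proof. by rewrite mxE. Qed.

End MatrixEntries.

Lemma sum_ord_pred (A : nmodType) m (G : nat -> A) :
  G m = 0 -> \sum_(i < m) G i.+1 = \sum_(i < m.-1) G i.+1.
Proof.
by case: m => [|m] Gm; rewrite ?big_ord0// big_ord_recr /= Gm addr0.
Qed.

(** * The Toda tensors and their master symmetries *)

Section Flaschka.
Variables (A : idomainType) (N : nat).
Local Notation n := (N.-1 + N)%N.
Variable x : 'I_n -> A.

Definition flaschka_a i : A :=
  if i is i'.+1 then oapp (fun k : 'I_N.-1 => x (lshift N k)) 0 (insub i')
  else 0.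

Definition flaschka_b i : A :=
  if i is i'.+1 then oapp (fun k : 'I_N => x (rshift N.-1 k)) 0 (insub i')
  else 0.

(** In the case analysis on an index the out-of-range disjunction records on which
side the index leaves the range, since neighbouring coordinates may vanish too. *)
Variant flaschka_a_spec i : A -> Type :=
  | FlaschkaAIn (k : 'I_N.-1) of i = k.+1 : flaschka_a_spec i (x (lshift N k))
  | FlaschkaAOut of (i == 0%N) || (N <= i)%N : flaschka_a_spec i 0.

Variant flaschka_b_spec i : A -> Type :=
  | FlaschkaBIn (k : 'I_N) of i = k.+1 : flaschka_b_spec i (x (rshift N.-1 k))
  | FlaschkaBOut of (i == 0%N) || (N < i)%N : flaschka_b_spec i 0.

Lemma flaschka_aP i : flaschka_a_spec i (flaschka_a i).
Proof.
case: i => [|i]; first by constructor.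
rewrite /flaschka_a; case: insubP => [k _ <-|iN]; first by constructor.
by constructor; lia.
Qed.

Lemma flaschka_bP i : flaschka_b_spec i (flaschka_b i).
Proof.
case: i => [|i]; first by constructor.
rewrite /flaschka_b; case: insubP => [k _ <-|iN]; first by constructor.
by constructor; lia.
Qed.

Lemma flaschka_aE (k : 'I_N.-1) : flaschka_a k.+1 = x (lshift N k).
Proof. by rewrite /flaschka_a valK. Qed.

Lemma flaschka_bE (k : 'I_N) : flaschka_b k.+1 = x (rshift N.-1 k).
Proof. by rewrite /flaschka_b valK. Qed.

Lemma flaschka_a0 : flaschka_a 0 = 0.
Proof. by []. Qed.

Lemma flaschka_b0 : flaschka_b 0 = 0.
Proof. by []. Qed.

Lemma flaschka_a_out i : (i == 0%N) || (N <= i)%N -> flaschka_a i = 0.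
Proof. by case: flaschka_aP => // k ->; have := ltn_ord k; lia. Qed.

Lemma flaschka_b_out i : (N < i)%N -> flaschka_b i = 0.
Proof. by case: flaschka_bP => // k ->; have := ltn_ord k; lia. Qed.

Arguments flaschka_a : simpl never.
Arguments flaschka_b : simpl never.

Local Notation a := flaschka_a.
Local Notation b := flaschka_b.

(** The partial sums that make the second master symmetry non-local. *)
Definition bsum i : A := \sum_(1 <= k < i) b k.

(** Also true at [i = 0], because [b 0 = 0]. *)
Lemma bsumS i : bsum i.+1 = bsum i + b i.
Proof.
case: i => [|i]; last by rewrite /bsum big_nat_recr.
by rewrite /bsum !big_geq// add0r.
Qed.

Definition toda_pi1_ab : 'M[A]_(N.-1, N) :=
  \matrix_(i, k)
    if k == i :> nat then - a i.+1 else if k == i.+1 :> nat then a i.+1 else 0.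

Definition toda_pi1 : 'M[A]_n := block_mx 0 toda_pi1_ab (- toda_pi1_ab^T) 0.

Variable half : A.

Definition toda_pi2_aa : 'M[A]_N.-1 :=
  \matrix_(i, k)
    if k == i.+1 :> nat then half * a i.+1 * a k.+1
    else if i == k.+1 :> nat then - (half * a k.+1 * a i.+1)
    else 0.

Definition toda_pi2_ab : 'M[A]_(N.-1, N) :=
  \matrix_(i, k)
    if k == i :> nat then - (a i.+1 * b i.+1)
    else if k == i.+1 :> nat then a i.+1 * b i.+2
    else 0.

Definition toda_pi2_bb : 'M[A]_N :=
  \matrix_(i, k)
    if k == i.+1 :> nat then 2 * a i.+1 ^+ 2
    else if i == k.+1 :> nat then - (2 * a k.+1 ^+ 2)
    else 0.

Definition toda_pi2 : 'M[A]_n :=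
  block_mx toda_pi2_aa toda_pi2_ab (- toda_pi2_ab^T) toda_pi2_bb.

Definition toda_X1_a i : A :=
  - i%:R * a i * b i + (i%:R + 2) * a i * b i.+1.

Definition toda_X1_b i : A :=
  (2 * i%:R + 3) * a i ^+ 2 + (1 - 2 * i%:R) * a i.-1 ^+ 2 + b i ^+ 2.

Definition toda_X1 : 'rV[A]_n :=
  row_mx (\row_(i < N.-1) toda_X1_a i.+1) (\row_(i < N) toda_X1_b i.+1).

Definition toda_X2_a i : A :=
  (2 - i%:R) * a i.-1 ^+ 2 * a i + (1 - i%:R) * a i * b i ^+ 2
  + a i * b i * b i.+1 + (i%:R + 1) * a i * a i.+1 ^+ 2
  + (i%:R + 1) * a i * b i.+1 ^+ 2 + a i ^+ 3
  + bsum i * a i * (b i.+1 - b i).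

Definition toda_X2_b i : A :=
  2 * bsum i * a i ^+ 2 - 2 * bsum i.-1 * a i.-1 ^+ 2
  + (2 * i%:R + 2) * a i ^+ 2 * b i + (2 * i%:R + 1) * a i ^+ 2 * b i.+1
  + (3 - 2 * i%:R) * a i.-1 ^+ 2 * b i.-1
  + (4 - 2 * i%:R) * a i.-1 ^+ 2 * b i + b i ^+ 3.

Definition toda_X2 : 'rV[A]_n :=
  row_mx (\row_(i < N.-1) toda_X2_a i.+1) (\row_(i < N) toda_X2_b i.+1).

Lemma toda_pi1_asym : toda_pi1^T = - toda_pi1.
Proof. by rewrite tr_block_mx opp_block_mx !linearN /= trmxK !trmx0 !oppr0 opprK. Qed.

Lemma toda_pi2_asym : toda_pi2^T = - toda_pi2.
Proof.
rewrite tr_block_mx opp_block_mx !linearN /= trmxK opprK.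
have -> : toda_pi2_aa^T = - toda_pi2_aa.
  apply/matrixP=> i k; rewrite !mxE.
  by do 2 case: eqP => ?; rewrite ?opprK ?oppr0//; lia.
have -> : toda_pi2_bb^T = - toda_pi2_bb; last by [].
apply/matrixP=> i k; rewrite !mxE.
by do 2 case: eqP => ?; rewrite ?opprK ?oppr0//; lia.
Qed.

Variable d : 'I_n -> A -> A.
Hypothesis (dd : forall k, derivation (d k)).
Hypothesis (dC : forall i k u, d i (d k u) = d k (d i u)).
Hypothesis (dx : forall i k, d i (x k) = (i == k)%:R).
Hypothesis (natr_neq0 : forall m, m.+1%:R != 0 :> A).
Hypothesis (halfE : 2 * half = 1).

Lemma vf_app_coord X k : vf_app d X (x k) = X 0 k.
Proof.
rewrite /vf_app (bigD1 k)//= dx eqxx mulr1 big1 ?addr0// => i ik.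
by rewrite dx (negPf ik) mulr0.
Qed.

Lemma bracket_coord P i k : bracket d P (x i) (x k) = P i k.
Proof.
rewrite /bracket vf_app_coord mxE (bigD1 k)//= dx eqxx mulr1 big1 ?addr0//.
by move=> l lk; rewrite dx (negPf lk) mulr0.
Qed.

Lemma vf_app_a (Xa Xb : nat -> A) i :
    (forall i, a i = 0 -> Xa i = 0) ->
  vf_app d (row_mx (\row_(i < N.-1) Xa i.+1) (\row_(i < N) Xb i.+1)) (a i) = Xa i.
Proof.
move=> Xa0; have := Xa0 i; case: flaschka_aP => [k ->|_ /(_ erefl) ->].
  by rewrite vf_app_coord row_mxEl mxE.
exact: der0 (vf_app_der dd _).
Qed.

Lemma vf_app_b (Xa Xb : nat -> A) i :
    Xb 0%N = 0 -> (forall i, (N < i)%N -> Xb i = 0) ->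
  vf_app d (row_mx (\row_(i < N.-1) Xa i.+1) (\row_(i < N) Xb i.+1)) (b i) = Xb i.
Proof.
move=> Xb0 XbN; have {XbN} := XbN i; case: flaschka_bP => [k -> _|].
  by rewrite vf_app_coord row_mxEr mxE.
rewrite (der0 (vf_app_der dd _)).
by case: i => [|i] //= Ni /(_ Ni).
Qed.

Local Notation D1 := (vf_app d toda_X1).
Local Notation D2 := (vf_app d toda_X2).

(** With the zero conventions the formulas for the components hold at every index;
no boundary case is left in the bracket computations. *)
Lemma app_X1_a i : D1 (a i) = toda_X1_a i.
Proof. by apply: vf_app_a => {}i ai0; rewrite /toda_X1_a ai0; ring. Qed.

Lemma app_X1_b i : D1 (b i) = toda_X1_b i.
Proof.
apply: vf_app_b => [|{}i iN]; rewrite /toda_X1_b /= ?flaschka_a0 ?flaschka_b0; first by ring.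
by rewrite (flaschka_b_out iN) !flaschka_a_out; try lia; ring.
Qed.

Lemma app_X2_a i : D2 (a i) = toda_X2_a i.
Proof. by apply: vf_app_a => {}i ai0; rewrite /toda_X2_a ai0; ring. Qed.

Lemma app_X2_b i : D2 (b i) = toda_X2_b i.
Proof.
apply: vf_app_b => [|{}i iN]; rewrite /toda_X2_b /= ?flaschka_a0 ?flaschka_b0; first by ring.
by rewrite (flaschka_b_out iN) !flaschka_a_out; try lia; ring.
Qed.

Local Notation B1 := (bracket d toda_pi1).
Local Notation B2 := (bracket d toda_pi2).

(** * Brackets of the Flaschka coordinates *)

Lemma bracket0l P v : bracket d P 0 v = 0.
Proof. exact: der0 (bracket_derl dd P v). Qed.
Lemma bracket0r P v : bracket d P v 0 = 0.
Proof. exact: der0 (bracket_derr dd P v). Qed.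

Lemma bracket1_aa i j : B1 (a i) (a j) = 0.
Proof.
case: flaschka_aP => [k _|_]; last by rewrite bracket0l.
case: flaschka_aP => [l _|_]; last by rewrite bracket0r.
by rewrite bracket_coord block_mxEul mxE.
Qed.

(** Stated for all indices, in range or not: [a i] vanishes as soon as one of the
brackets would involve a coordinate that does not exist. *)
Lemma bracket1_ab i j : B1 (a i) (b j) = a i * ((j == i.+1)%:R - (j == i)%:R).
Proof.
case: (flaschka_aP i) => [k ik|_]; last by rewrite bracket0l mul0r.
case: (flaschka_bP j) => [l jl|jN].
  rewrite bracket_coord block_mxEur mxE flaschka_aE ik jl !eqSS.
  case: eqP => [->|_]; first by rewrite (ltn_eqF (ltnSn k)) /=; ring.
  by case: eqP => _ /=; ring.
rewrite bracket0r; have := ltn_ord k; do 2 (case: eqP => [?|_]; first by lia).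
by rewrite subrr mulr0.
Qed.

Lemma bracket1_bb i j : B1 (b i) (b j) = 0.
Proof.
case: flaschka_bP => [k _|_]; last by rewrite bracket0l.
case: flaschka_bP => [l _|_]; last by rewrite bracket0r.
by rewrite bracket_coord block_mxEdr mxE.
Qed.

Lemma bracket2_aa i j :
  B2 (a i) (a j) = half * a i * a j * ((j == i.+1)%:R - (i == j.+1)%:R).
Proof.
case: (flaschka_aP i) => [k ik|_]; last by rewrite bracket0l; ring.
case: (flaschka_aP j) => [l jl|jN]; last by rewrite bracket0r; ring.
rewrite bracket_coord block_mxEul mxE !flaschka_aE ik jl !eqSS.
by do 2 case: eqP => ? /=; try lia; ring.
Qed.

Lemma bracket2_ab i j : B2 (a i) (b j) = a i * b j * ((j == i.+1)%:R - (j == i)%:R).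
Proof.
case: (flaschka_aP i) => [k ik|_]; last by rewrite bracket0l; ring.
case: (flaschka_bP j) => [l jl|jN]; last by rewrite bracket0r; ring.
rewrite bracket_coord block_mxEur mxE flaschka_aE ik jl !eqSS.
rewrite -(flaschka_bE l); case: eqP => [->|_].
  by rewrite (ltn_eqF (ltnSn k)) /=; ring.
by case: eqP => [->|_] /=; ring.
Qed.

Lemma bracket2_bb i j : B2 (b i) (b j) =
  2 * a i ^+ 2 * (j == i.+1)%:R - 2 * a j ^+ 2 * (i == j.+1)%:R.
Proof.
case: (flaschka_bP i) => [k ik|iN]; last first.
  rewrite bracket0l; do 2 case: eqP => ? /=; try ring; try lia.
  - by rewrite (@flaschka_a_out i); try lia; ring.
  - by rewrite (@flaschka_a_out j); try lia; ring.
case: (flaschka_bP j) => [l jl|jN]; last first.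
  rewrite bracket0r; do 2 case: eqP => ? /=; try ring; try lia.
  - by have ? := ltn_ord k; rewrite (@flaschka_a_out i); try lia; ring.
  - by have ? := ltn_ord k; rewrite (@flaschka_a_out j); try lia; ring.
rewrite bracket_coord block_mxEdr mxE ik jl !eqSS.
by do 2 case: eqP => ? /=; try lia; ring.
Qed.

(** The bracket of [a j] with a partial sum telescopes: the non-local terms of the
second master symmetry have local brackets. *)
Lemma bracket1_a_bsum j i : B1 (a j) (bsum i) = - a j * (i == j.+1)%:R.
Proof.
elim: i => [|i IHi].
  by rewrite /bsum big_geq// bracket0r; case: eqP => [//|_] /=; ring.
rewrite bsumS (derD (bracket_derr dd _ _)) IHi bracket1_ab !eqSS.
by ring.
Qed.

Lemma bracket1_b_bsum j i : B1 (b j) (bsum i) = 0.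
Proof. by rewrite (der_sum (bracket_derr dd _ _)) big1// => k _; rewrite bracket1_bb. Qed.

Lemma der_half (D : A -> A) : derivation D -> D half = 0.
Proof.
move=> dD; apply: (mulfI (natr_neq0 1)).
by rewrite -(der_natM dD) halfE (der1 dD) mulr0.
Qed.

(** The Leibniz rules of the bracket as one rewriting rule. *)
Lemma bracketlE P w :
  ((forall u v, bracket d P (u + v)%R w = (bracket d P u w + bracket d P v w)%R) *
  (forall u, bracket d P (- u) w = - bracket d P u w) *
  (forall u v, bracket d P (u * v)%R w = (bracket d P u w * v + u * bracket d P v w)%R) *
  (forall m, bracket d P m%:R w = 0) *
  (forall u m, bracket d P (u ^+ m.+1) w = (m.+1%:R * u ^+ m * bracket d P u w)%R) *
  (bracket d P 1 w = 0) * (bracket d P half w = 0))%type.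
Proof.
have dD := bracket_derl dd P w.
do !split; [exact: derD dD|exact: derN dD|exact: derM dD|exact: der_nat dD|
  exact: derX dD|exact: der1 dD|exact: der_half dD].
Qed.

Lemma bracketrE P w :
  ((forall u v, bracket d P w (u + v)%R = (bracket d P w u + bracket d P w v)%R) *
  (forall u, bracket d P w (- u) = - bracket d P w u) *
  (forall u v, bracket d P w (u * v)%R = (bracket d P w u * v + u * bracket d P w v)%R) *
  (forall m, bracket d P w m%:R = 0) *
  (forall u m, bracket d P w (u ^+ m.+1) = (m.+1%:R * u ^+ m * bracket d P w u)%R) *
  (bracket d P w 1 = 0) * (bracket d P w half = 0))%type.
Proof.
have dD := bracket_derr dd P w.
do !split; [exact: derD dD|exact: derN dD|exact: derM dD|exact: der_nat dD|
  exact: derX dD|exact: der1 dD|exact: der_half dD].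
Qed.

(** An antisymmetric bivector is determined by the brackets of coordinates, and it is
enough to consider pairs of the same kind in increasing order. *)
Lemma bv_eqP (P Q : 'M[A]_n) : P^T = - P -> Q^T = - Q ->
    (forall i k, bracket d P (a i.+1) (a (i + k).+1) = bracket d Q (a i.+1) (a (i + k).+1)) ->
    (forall i k, bracket d P (a i.+1) (b k.+1) = bracket d Q (a i.+1) (b k.+1)) ->
    (forall i k, bracket d P (b i.+1) (b (i + k).+1) = bracket d Q (b i.+1) (b (i + k).+1)) ->
  P = Q.
Proof.
move=> Pa Qa aa ab bb; apply/matrixP=> i k; rewrite -!bracket_coord.
case: (split_ordP i) => {}i ->; case: (split_ordP k) => {}k ->;
  rewrite -?flaschka_aE -?flaschka_bE.
- have [ik|/ltnW ki] := leqP i k; first by rewrite -(subnKC ik).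
  by rewrite -(subnKC ki) (bracket_asym d Pa) (bracket_asym d Qa) aa.
- exact: ab.
- by rewrite (bracket_asym d Pa) (bracket_asym d Qa) ab.
- have [ik|/ltnW ki] := leqP i k; first by rewrite -(subnKC ik).
  by rewrite -(subnKC ki) (bracket_asym d Pa) (bracket_asym d Qa) bb.
Qed.

Let bracket1_ba i j : B1 (b i) (a j) = - a j * ((i == j.+1)%:R - (i == j)%:R).
Proof. by rewrite (bracket_asym d toda_pi1_asym) bracket1_ab mulNr. Qed.
Let bracket1_bsum_a i j : B1 (bsum i) (a j) = a j * (i == j.+1)%:R.
Proof. by rewrite (bracket_asym d toda_pi1_asym) bracket1_a_bsum mulNr opprK. Qed.
Let bracket1_bsum_b i j : B1 (bsum i) (b j) = 0.
Proof. by rewrite (bracket_asym d toda_pi1_asym) bracket1_b_bsum oppr0. Qed.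
Let bracket2_ba i j : B2 (b i) (a j) = - a j * b i * ((i == j.+1)%:R - (i == j)%:R).
Proof. by rewrite (bracket_asym d toda_pi2_asym) bracket2_ab !mulNr. Qed.
Let B1E := (bracket1_aa, bracket1_ab, bracket1_ba, bracket1_bb,
  bracket1_a_bsum, bracket1_bsum_a, bracket1_b_bsum, bracket1_bsum_b).
Let B2E := (bracket2_aa, bracket2_ab, bracket2_ba, bracket2_bb).
Let D1E := (app_X1_a, app_X1_b).
Let D2E := (app_X2_a, app_X2_b).

(** * Lie derivatives of the linear bracket *)

Let bracket_lieE := bracket_lie dd dC.

Lemma natr_eqF (i j : nat) : i <> j -> (i == j)%:R = 0 :> A.
Proof. by move/eqP/negPf->. Qed.
Lemma natr_eqT (i j : nat) : i = j -> (i == j)%:R = 1 :> A.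
Proof. by move=> ->; rewrite eqxx. Qed.

(** Evaluates the indicators of equalities between indices at a known offset. *)
Ltac decide_eqs :=
  repeat match goal with
  | |- context [(nat_of_bool (?i == ?j))%:R] =>
     first [rewrite (@natr_eqF i j); [|clear; lia]
           |rewrite (@natr_eqT i j); [|clear; lia]]
  end.

(** All the brackets involved have range at most three, so the last case, of
an offset at least four, is the generic one. *)
Ltac offset_cases k := case: k => [|[|[|[|k]]]]; rewrite ?addnS ?addn0.

(** Both sides are affine in [half]. An identity that holds because [2 * half = 1]
is a multiple of [1 - 2 * half], and the cofactor is its value at [half = 0]. *)
Ltac ring_half :=
  match goal with |- ?L = ?R =>
    let fL := eval pattern half in L in
    let gR := eval pattern half in R in
    match fL with ?f half => match gR with ?g half =>
      apply/eqP; rewrite -subr_eq0; apply/eqP;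
      transitivity ((f (0 : A) - g (0 : A)) * (1 - 2 * half));
      [cbv beta; ring | by rewrite halfE (subrr 1) [LHS]mulr0] end end end.

(** Instance [i = 1], [j = 1] of the relations [L_(X_i) pi_j = (j - i - 2) pi_(i + j)]. *)
Lemma lie_X1_pi1 : lie_bv d toda_X1 toda_pi1 = (- 2) *: toda_pi2.
Proof.
apply: bv_eqP.
- by apply: (lie_bv_asym dd); apply: toda_pi1_asym.
- by rewrite linearZ /= toda_pi2_asym scalerN.
- move=> i j; rewrite bracket_lieE !D1E bracket1_aa (der0 (vf_app_der dd _)).
  rewrite /toda_X1_a bracketZ !(bracketlE, bracketrE) !B1E !B2E /=.
  offset_cases j; decide_eqs; ring_half.
- move=> i j; rewrite bracket_lieE !D1E bracket1_ab bracketZ bracket2_ab.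
  rewrite (derM (vf_app_der dd _)) (derB (vf_app_der dd _)) !(der_nat (vf_app_der dd _)) D1E.
  rewrite /toda_X1_a /toda_X1_b !(bracketlE, bracketrE) !B1E /=.
  have [/subnKC <-|/subnKC <-] := leqP i j.
    move: (j - i)%N => {}j; offset_cases j; decide_eqs; ring_half.
  move: (i - j.+1)%N => {}i; offset_cases i; decide_eqs; ring_half.
- move=> i j; rewrite bracket_lieE !D1E bracket1_bb (der0 (vf_app_der dd _)).
  rewrite /toda_X1_b bracketZ !(bracketlE, bracketrE) !B1E !B2E /=.
  offset_cases j; decide_eqs; ring_half.
Qed.

(** Both sides are [- 3 pi_3]. This is the one identity that ties the two master
symmetries together, and it makes the tensor [pi_4], defined with [X2], fit the
sequence generated by [X1]. *)
Lemma lie_X2_pi1 : lie_bv d toda_X2 toda_pi1 = 3 *: lie_bv d toda_X1 toda_pi2.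
Proof.
have D1n := der_nat (vf_app_der dd toda_X1).
have D1M := derM (vf_app_der dd toda_X1).
have D1B := derB (vf_app_der dd toda_X1).
have D1h := der_half (vf_app_der dd toda_X1).
have D1X := derX (vf_app_der dd toda_X1).
have D2n := der_nat (vf_app_der dd toda_X2).
have D2M := derM (vf_app_der dd toda_X2).
have D2B := derB (vf_app_der dd toda_X2).
pose DE := (D1B, D1M, D1n, D1h, D1X, D2B, D2M, D2n).
apply: bv_eqP.
- by apply: (lie_bv_asym dd); apply: toda_pi1_asym.
- by rewrite linearZ /= (lie_bv_asym dd) ?scalerN//; apply: toda_pi2_asym.
- move=> i j; rewrite bracketZ !bracket_lieE !D1E !D2E bracket1_aa bracket2_aa.
  rewrite (der0 (vf_app_der dd _)).
  rewrite !DE !D1E.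
  rewrite /toda_X1_a /toda_X2_a !(bracketlE, bracketrE) !B1E !B2E /=.
  offset_cases j; decide_eqs; rewrite !bsumS; ring_half.
- move=> i j; rewrite bracketZ !bracket_lieE !D1E !D2E bracket1_ab bracket2_ab.
  rewrite !DE !D1E !D2E.
  rewrite /toda_X1_a /toda_X1_b /toda_X2_a /toda_X2_b !(bracketlE, bracketrE) !B1E !B2E /=.
  have [/subnKC <-|/subnKC <-] := leqP i j.
    move: (j - i)%N => {}j; offset_cases j; decide_eqs; rewrite !bsumS; ring_half.
  move: (i - j.+1)%N => {}i; offset_cases i; decide_eqs; rewrite !bsumS; ring_half.
- move=> i j; rewrite bracketZ !bracket_lieE !D1E !D2E bracket1_bb bracket2_bb.
  rewrite (der0 (vf_app_der dd _)).
  rewrite !DE !D1E.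
  rewrite /toda_X1_a /toda_X1_b /toda_X2_b !(bracketlE, bracketrE) !B1E !B2E /=.
  offset_cases j; decide_eqs; rewrite !bsumS; ring_half.
Qed.

(** * Powers of the Jacobi matrix *)

(** Matrices are given by coefficient functions with 1-based indices, so that a
neighbour outside the range is an ordinary value multiplied by a vanishing [a i]. *)
Definition mx_of (F : nat -> nat -> A) : 'M[A]_N := \matrix_(i, k) F i.+1 k.+1.

Definition jacobi_coef i k : A :=
  (i == k)%:R * b i + (k == i.+1)%:R * a i + (i == k.+1)%:R * a k.

Definition flaschka_jacobi := mx_of jacobi_coef.
Local Notation L := flaschka_jacobi.

(** Products by the Jacobi matrix on either side, as three-term recurrences on
coefficient functions. *)
Definition jacobi_l (F : nat -> nat -> A) i k :=
  a i.-1 * F i.-1 k + b i * F i k + a i * F i.+1 k.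
Definition jacobi_r (F : nat -> nat -> A) i k :=
  F i k.-1 * a k.-1 + F i k * b k + F i k.+1 * a k.

Lemma eq_mx_of F G : (forall i k, F i.+1 k.+1 = G i.+1 k.+1) -> mx_of F = mx_of G.
Proof. by move=> FG; apply/matrixP=> i k; rewrite !mxE. Qed.

Lemma sum_delta (m : nat) (G : nat -> A) : ((m == 0%N) || (N < m)%N -> G m = 0) ->
  \sum_(l < N) (l.+1 == m)%:R * G l.+1 = G m.
Proof.
case: m => [|m] Gm.
  by rewrite big1 ?Gm// => l _; rewrite mul0r.
have [mN|Nm] := ltnP m N.
  rewrite (bigD1 (Ordinal mN))//= eqxx mul1r big1 ?addr0// => l.
  rewrite -val_eqE /= => lm; rewrite eqSS (negPf lm) mul0r//.
rewrite Gm ?ltnS ?Nm ?orbT// big1// => l _.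
by rewrite eqSS ltn_eqF ?mul0r//; apply: leq_trans Nm.
Qed.

Lemma mul_jacobi_mx F : L *m mx_of F = mx_of (jacobi_l F).
Proof.
apply/matrixP=> i k; rewrite !mxE /jacobi_l /=.
transitivity (\sum_(l < N) (l.+1 == i)%:R * (a l.+1 * F l.+1 k.+1) +
  \sum_(l < N) (l.+1 == i.+1)%:R * (b l.+1 * F l.+1 k.+1) +
  \sum_(l < N) (l.+1 == i.+2)%:R * (a i.+1 * F l.+1 k.+1)).
  rewrite -!big_split; apply: eq_bigr => l _ /=.
  rewrite !mxE /jacobi_coef !eqSS [i == l :> nat]eq_sym [i == l.+1 :> nat]eq_sym.
  by case: (nat_of_ord l =P i) => [->|_] /=; ring.
congr (_ + _ + _).
- rewrite (@sum_delta i (fun l => a l * F l k.+1))// => iN.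
  by rewrite flaschka_a_out ?mul0r//; have := ltn_ord i; lia.
- rewrite (@sum_delta i.+1 (fun l => b l * F l k.+1))// => iN.
  by have := ltn_ord i; lia.
- rewrite (@sum_delta i.+2 (fun l => a i.+1 * F l k.+1))// => iN.
  by rewrite flaschka_a_out ?mul0r//; lia.
Qed.

Lemma jacobi_coefC i k : jacobi_coef i k = jacobi_coef k i.
Proof.
rewrite /jacobi_coef eq_sym; case: eqP => [->|_] /=; ring.
Qed.

Lemma tr_mx_of F : (mx_of F)^T = mx_of (fun i k => F k i).
Proof. by apply/matrixP=> i k; rewrite !mxE. Qed.

Lemma jacobi_tr : L^T = L.
Proof. by rewrite tr_mx_of; apply: eq_mx_of => i k; rewrite jacobi_coefC. Qed.

Lemma mul_mx_jacobi F : mx_of F *m L = mx_of (jacobi_r F).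
Proof.
apply: trmx_inj; rewrite trmx_mul jacobi_tr !tr_mx_of mul_jacobi_mx.
by apply: eq_mx_of => i k; rewrite /jacobi_l /jacobi_r; ring.
Qed.

Definition jacobi_pow m : nat -> nat -> A :=
  iter m jacobi_l (fun i k => (i == k)%:R).

Lemma jacobi_powE m : L ^+ m = mx_of (jacobi_pow m).
Proof.
elim: m => [|m IHm]; last by rewrite exprS IHm -mulmxE mul_jacobi_mx.
by apply/matrixP=> i k; rewrite !mxE /= ?eqSS.
Qed.

Lemma jacobi_l_delta i k :
  jacobi_l (fun i k => (i == k)%:R) i k = jacobi_coef i k.
Proof.
rewrite /jacobi_l /jacobi_coef; case: i => [|i].
  rewrite flaschka_a0 flaschka_b0 (_ : (0%N == k.+1) = false)//.
  by case: eqP => [<-|_] /=; rewrite ?flaschka_a0; ring.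
rewrite /= [k == _]eq_sym eqSS.
by case: (i =P k) => [->|?] /=; ring.
Qed.

Lemma jacobi_r_delta i k :
  jacobi_r (fun i k => (i == k)%:R) i k = jacobi_coef i k.
Proof.
rewrite jacobi_coefC -jacobi_l_delta /jacobi_r /jacobi_l.
by rewrite ![i == _]eq_sym; ring.
Qed.

(** The two recurrences commute and agree on the identity matrix. *)
Lemma jacobi_pow_lr m i k : jacobi_pow m.+1 i k = jacobi_r (jacobi_pow m) i k.
Proof.
elim: m i k => [|m IHm] i k; first by rewrite jacobi_r_delta -jacobi_l_delta.
rewrite -[LHS]/(jacobi_l (jacobi_pow m.+1) i k) {1}/jacobi_l !IHm /jacobi_r.
by rewrite -[jacobi_pow m.+1]/(jacobi_l (jacobi_pow m)) /jacobi_l; ring.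
Qed.

Lemma jacobi_powC m i k : jacobi_pow m i k = jacobi_pow m k i.
Proof.
elim: m i k => [|m IHm] i k; first by rewrite /= eq_sym.
rewrite jacobi_pow_lr /jacobi_r -[RHS]/(jacobi_l (jacobi_pow m) k i) /jacobi_l.
by rewrite !(IHm i); ring.
Qed.

(** Only the diagonal and the first off-diagonal of a symmetric matrix see the
derivative of the Jacobi matrix. *)
Lemma trace_der_jacobi (D : A -> A) (dD : derivation D) F :
    (forall i k, F i k = F k i) ->
  \tr (mx_of F *m map_mx D L) =
    \sum_(l < N) (F l.+1 l.+1 * D (b l.+1) + 2 * (F l.+1 l.+2 * D (a l.+1))).
Proof.
move=> FC.
pose E i k := (i == k)%:R * D (b i) + (k == i.+1)%:R * D (a i) + (i == k.+1)%:R * D (a k).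
have -> : map_mx D L = mx_of E.
  apply/matrixP=> i k; rewrite !mxE !(derD dD) !(derM dD) !(der_nat dD) /E; ring.
rewrite /mxtrace.
transitivity (\sum_(i < N) \sum_(l < N) (l.+1 == i.+1)%:R * (F i.+1 l.+1 * D (b l.+1))
  + \sum_(i < N) \sum_(l < N) (l.+1 == i.+2)%:R * (F i.+1 l.+1 * D (a i.+1))
  + \sum_(i < N) \sum_(l < N) (l.+1 == i.+2)%:R * (F i.+1 l.+1 * D (a i.+1))).
  rewrite [X in _ = _ + X]exchange_big -!big_split; apply: eq_bigr => i _ /=.
  rewrite mxE -!big_split; apply: eq_bigr => l _ /=.
  by rewrite !mxE /E (FC l.+1 i.+1); ring.
rewrite -!big_split; apply: eq_bigr => i _ /=.
rewrite (@sum_delta i.+1 (fun l => F i.+1 l * D (b l))); last first.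
  by move=> iN; have := ltn_ord i; lia.
rewrite (@sum_delta i.+2 (fun l => F i.+1 l * D (a i.+1))); first by ring.
by move=> iN; rewrite flaschka_a_out ?(der0 dD) ?mulr0//; lia.
Qed.

Lemma der_jacobi_powX (D : A -> A) m : derivation D ->
  D (\tr (L ^+ m.+1)) = m.+1%:R *
    \sum_(l < N) (jacobi_pow m l.+1 l.+1 * D (b l.+1)
                  + 2 * (jacobi_pow m l.+1 l.+2 * D (a l.+1))).
Proof.
move=> dD; rewrite (der_mxtraceX dD) jacobi_powE trace_der_jacobi//.
exact: jacobi_powC.
Qed.

(** An isospectral perturbation [M L - L M] does not change the traces of powers,
so the spectrum moves as under [L' = L ^+ p.+1]. *)
Lemma lax_trace (D : A -> A) (M : 'M[A]_N) p : derivation D ->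
    map_mx D L = M *m L - L *m M + L ^+ p.+1 ->
  forall m, D (\tr (L ^+ m.+1)) = m.+1%:R * \tr (L ^+ (m + p).+1).
Proof.
move=> dD lax m; rewrite (der_mxtraceX dD) lax; congr (_ * _).
rewrite mulmxDr mulmxBr mxtraceD linearB /= mulmxA mxtrace_mulC !mulmxA.
by rewrite !mulmxE -exprS -exprSr subrr add0r -exprD addnS.
Qed.

(** * Lax equations of the master symmetries *)

(** The antisymmetric matrix of the Lax equation. The coefficients [i.+1] have to
increase by 1 to cancel the second off-diagonal of [L ^+ 2]. *)
Definition lax1 i k : A :=
  (k == i.+1)%:R * (i.+1%:R * a i) - (i == k.+1)%:R * (k.+1%:R * a k).

Lemma laxP (D : A -> A) (F G : nat -> nat -> A) : derivation D ->
  (forall i k, D (jacobi_coef i.+1 k.+1) =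
    jacobi_r F i.+1 k.+1 - jacobi_l F i.+1 k.+1 + G i.+1 k.+1) ->
  map_mx D L = mx_of F *m L - L *m mx_of F + mx_of G.
Proof.
move=> dD DF; rewrite mul_mx_jacobi mul_jacobi_mx.
by apply/matrixP=> i k; rewrite !mxE DF.
Qed.

Lemma lax_X1 : map_mx D1 L = mx_of lax1 *m L - L *m mx_of lax1 + L ^+ 2.
Proof.
have dD := vf_app_der dd toda_X1.
have -> : L ^+ 2 = mx_of (jacobi_l jacobi_coef).
  by rewrite expr2 -mulmxE mul_jacobi_mx.
apply: laxP => // i k.
rewrite !(derD dD, derM dD, der_nat dD) !D1E.
rewrite /toda_X1_a /toda_X1_b /jacobi_r /jacobi_l /lax1 /jacobi_coef /=.
have [/subnKC <-|/subnKC <-] := leqP i k.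
  by move: (k - i)%N => {}k; offset_cases k; decide_eqs; ring.
by move: (i - k.+1)%N => {}i; offset_cases i; decide_eqs; ring.
Qed.

(** The antisymmetric matrix of the second Lax equation. Its second off-diagonal
cancels the third one of [L ^+ 3], and the partial sums in the first off-diagonal come
from cancelling the second one. *)
Definition lax2 i k : A :=
  let c i := a i * (bsum i + i%:R * (b i + b i.+1)) in
  let e i := i%:R * a i * a i.+1 in
  (k == i.+1)%:R * c i - (i == k.+1)%:R * c k
  + (k == i.+2)%:R * e i - (i == k.+2)%:R * e k.

Lemma lax_X2 : map_mx D2 L = mx_of lax2 *m L - L *m mx_of lax2 + L ^+ 3.
Proof.
have dD := vf_app_der dd toda_X2.
have -> : L ^+ 3 = mx_of (jacobi_r (jacobi_l jacobi_coef)).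
  by rewrite exprSr expr2 -!mulmxE mul_jacobi_mx mul_mx_jacobi.
apply: laxP => // i k.
rewrite !(derD dD, derM dD, der_nat dD) !D2E.
rewrite /toda_X2_a /toda_X2_b /jacobi_r /jacobi_l /lax2 /jacobi_coef /=.
have [/subnKC <-|/subnKC <-] := leqP i k.
  by move: (k - i)%N => {}k; offset_cases k; decide_eqs; rewrite !bsumS; ring.
by move: (i - k.+1)%N => {}i; offset_cases i; decide_eqs; rewrite !bsumS; ring.
Qed.

(** Indexed so that its differential is [m.+1] times a linear image of [L ^+ m]. *)
Definition jacobi_trace m : A := \tr (L ^+ m.+1).
Local Notation h := jacobi_trace.

Lemma X1_trace m : D1 (h m) = m.+1%:R * h m.+1.
Proof. by rewrite (lax_trace (vf_app_der dd _) lax_X1) addn1. Qed.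

Lemma X2_trace m : D2 (h m) = m.+1%:R * h m.+2.
Proof. by rewrite (lax_trace (vf_app_der dd _) lax_X2) addn2. Qed.

(** * Lenard relations *)

Lemma bracket_trace P u m : bracket d P u (h m) = m.+1%:R *
  \sum_(l < N) (jacobi_pow m l.+1 l.+1 * bracket d P u (b l.+1)
                + 2 * (jacobi_pow m l.+1 l.+2 * bracket d P u (a l.+1))).
Proof. by rewrite /h (der_jacobi_powX _ (bracket_derr dd P u)). Qed.

Lemma sharp_bracket P v k : sharp d P v 0 k = bracket d P (x k) v.
Proof. by rewrite /bracket vf_app_coord. Qed.

(** With [H_k = \tr (L ^+ k) / k] this says that [Q] and [P] send [d H_k] and
[d H_(k+1)], for every positive [k], to the same vector field; the factors clear
denominators. *)
Definition lenard (P Q : 'M[A]_n) :=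
  forall m, m.+2%:R *: sharp d Q (h m) = m.+1%:R *: sharp d P (h m.+1).

Let jacobi_powS m i k : jacobi_pow m.+1 i k = jacobi_l (jacobi_pow m) i k.
Proof. by []. Qed.

Let sum_bracket1_a i (F : nat -> nat -> A) :
  \sum_(l < N) (F l.+1 l.+1 * B1 (a i.+1) (b l.+1)
                + 2 * (F l.+1 l.+2 * B1 (a i.+1) (a l.+1)))
  = a i.+1 * (F i.+2 i.+2 - F i.+1 i.+1).
Proof.
transitivity (\sum_(l < N) (l.+1 == i.+2)%:R * (a i.+1 * F l.+1 l.+1)
   - \sum_(l < N) (l.+1 == i.+1)%:R * (a i.+1 * F l.+1 l.+1)).
  by rewrite -sumrB; apply: eq_bigr => l _; rewrite bracket1_ab bracket1_aa; ring.
rewrite (@sum_delta i.+2 (fun l => a i.+1 * F l l)).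
  rewrite (@sum_delta i.+1 (fun l => a i.+1 * F l l)); first by ring.
  by move=> ?; rewrite flaschka_a_out ?mul0r//; lia.
by move=> ?; rewrite flaschka_a_out ?mul0r//; lia.
Qed.

Let sum_bracket2_a i (F : nat -> nat -> A) :
  \sum_(l < N) (F l.+1 l.+1 * B2 (a i.+1) (b l.+1)
                + 2 * (F l.+1 l.+2 * B2 (a i.+1) (a l.+1)))
  = a i.+1 * (b i.+2 * F i.+2 i.+2 - b i.+1 * F i.+1 i.+1
      + a i.+2 * F i.+2 i.+3 - a i * F i i.+1).
Proof.
transitivity (\sum_(l < N) (l.+1 == i.+2)%:R * (a i.+1 * b l.+1 * F l.+1 l.+1)
   - \sum_(l < N) (l.+1 == i.+1)%:R * (a i.+1 * b l.+1 * F l.+1 l.+1)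
   + \sum_(l < N) (l.+1 == i.+2)%:R * (a i.+1 * a l.+1 * F l.+1 l.+2)
   - \sum_(l < N) (l.+1 == i)%:R * (a i.+1 * a l.+1 * F l.+1 l.+2)).
  rewrite -sumrB -big_split -sumrB; apply: eq_bigr => l _ /=.
  rewrite bracket2_ab bracket2_aa !eqSS [i == _]eq_sym.
  have pull_half u v w z : 2 * (u * (half * v * w * z)) = u * (v * w * z).
    by rewrite -[RHS]mul1r -[X in _ = X * _]halfE; ring.
  by rewrite pull_half; ring.
rewrite (@sum_delta i.+2 (fun l => a i.+1 * b l * F l l)).
  rewrite (@sum_delta i.+1 (fun l => a i.+1 * b l * F l l)).
    rewrite (@sum_delta i.+2 (fun l => a i.+1 * a l * F l l.+1)).
      rewrite (@sum_delta i (fun l => a i.+1 * a l * F l l.+1)); first by ring.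
      by move=> ?; rewrite (@flaschka_a_out i) ?mulr0 ?mul0r//; lia.
    all: by move=> ?; rewrite flaschka_a_out ?mul0r//; lia.
Qed.

Let sum_bracket1_b i (F : nat -> nat -> A) :
  \sum_(l < N) (F l.+1 l.+1 * B1 (b i.+1) (b l.+1)
                + 2 * (F l.+1 l.+2 * B1 (b i.+1) (a l.+1)))
  = 2 * (a i.+1 * F i.+1 i.+2 - a i * F i i.+1).
Proof.
transitivity (\sum_(l < N) (l.+1 == i.+1)%:R * (2 * a l.+1 * F l.+1 l.+2)
   - \sum_(l < N) (l.+1 == i)%:R * (2 * a l.+1 * F l.+1 l.+2)).
  rewrite -sumrB; apply: eq_bigr => l _; rewrite bracket1_ba bracket1_bb.
  by rewrite !eqSS ![i == _]eq_sym; ring.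
rewrite (@sum_delta i.+1 (fun l => 2 * a l * F l l.+1)).
  rewrite (@sum_delta i (fun l => 2 * a l * F l l.+1)); first by ring.
  by move=> ?; rewrite flaschka_a_out ?mulr0 ?mul0r//; lia.
by move=> ?; rewrite flaschka_a_out ?mulr0 ?mul0r//; lia.
Qed.

Let sum_bracket2_b i (F : nat -> nat -> A) :
  \sum_(l < N) (F l.+1 l.+1 * B2 (b i.+1) (b l.+1)
                + 2 * (F l.+1 l.+2 * B2 (b i.+1) (a l.+1)))
  = 2 * (a i.+1 ^+ 2 * F i.+2 i.+2 - a i ^+ 2 * F i i
         + b i.+1 * (a i.+1 * F i.+1 i.+2 - a i * F i i.+1)).
Proof.
transitivity (\sum_(l < N) (l.+1 == i.+2)%:R * (2 * a i.+1 ^+ 2 * F l.+1 l.+1)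
   - \sum_(l < N) (l.+1 == i)%:R * (2 * a l.+1 ^+ 2 * F l.+1 l.+1)
   + \sum_(l < N) (l.+1 == i.+1)%:R * (2 * b i.+1 * a l.+1 * F l.+1 l.+2)
   - \sum_(l < N) (l.+1 == i)%:R * (2 * b i.+1 * a l.+1 * F l.+1 l.+2)).
  rewrite -sumrB -big_split -sumrB; apply: eq_bigr => l _ /=.
  rewrite bracket2_ba bracket2_bb.
  by rewrite !eqSS ![i == _]eq_sym; ring.
rewrite (@sum_delta i.+2 (fun l => 2 * a i.+1 ^+ 2 * F l l)).
  rewrite (@sum_delta i (fun l => 2 * a l ^+ 2 * F l l)).
    rewrite (@sum_delta i.+1 (fun l => 2 * b i.+1 * a l * F l l.+1)).
      rewrite (@sum_delta i (fun l => 2 * b i.+1 * a l * F l l.+1)); first by ring.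
    all: by move=> ?; rewrite flaschka_a_out ?expr0n ?mulr0 ?mul0r//; lia.
Qed.

(** The entries of both sides are local expressions in [L ^+ m] and [L ^+ m.+1], and
the second matrix is expanded by the recurrence on the left or on the right
according to which neighbours have to cancel. *)
Lemma lenard_pi12 : lenard toda_pi1 toda_pi2.
Proof.
move=> m; apply/rowP=> k.
rewrite !mxZE !sharp_bracket !bracket_trace mulrCA; congr (_ * (_ * _)).
case: (split_ordP k) => {}k ->; rewrite -?flaschka_aE -?flaschka_bE.
  rewrite sum_bracket1_a sum_bracket2_a !jacobi_powS /jacobi_l /=.
  rewrite (jacobi_powC m k.+2 k.+1) (jacobi_powC m k.+3); ring.
rewrite sum_bracket1_b sum_bracket2_b [jacobi_pow m.+1 k _]jacobi_pow_lr jacobi_powS.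
by rewrite /jacobi_l /jacobi_r /=; ring.
Qed.

Lemma addr2_eq0 (u : A) : u + u = 0 -> u = 0.
Proof. by move=> uu; apply: (mulfI (natr_neq0 1)); rewrite mulr0 -[RHS]uu; ring. Qed.

(** Differentiates a Lenard relation along a master symmetry of degree [p]. The Lie
derivative of [P] is known on differentials of traces, with multiplier [e]; that of [Q]
follows, with multiplier [e + 1]. The tensor [T] sits [p] steps above [P] in the
hierarchy; it is [Q] itself when [p = 1]. *)
Lemma lenard_lie X P Q T (e : A) p :
    (forall m, vf_app d X (h m) = m.+1%:R * h (m + p)) ->
    lenard P Q ->
    (forall m, sharp d (lie_bv d X P) (h m) = e *: sharp d T (h m)) ->
    (forall m, (m + p).+1%:R *: sharp d T (h m.+1) = m.+2%:R *: sharp d Q (h (m + p))) ->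
  forall m, m.+2%:R *: sharp d (lie_bv d X Q) (h m) =
            (m.+1%:R * (e + 1)) *: sharp d T (h m.+1).
Proof.
move=> Xh PQ XP TQ m.
have /rowP E1 := congr1 (lie_vf d X) (PQ m).
have /rowP E2 := PQ (m + p)%N.
have /rowP E3 := TQ m.
apply/rowP=> k; move: (E1 k) (E2 k) (E3 k) => {E1 E2 E3}.
rewrite !(lie_vfZr dd) !(der_nat (vf_app_der dd X)) !scale0r !add0r.
rewrite !(lie_vf_sharp dd dC) !Xh XP !(sharp_natM dd) addSn.
rewrite !(mxZE, mxDE).
move: (sharp d (lie_bv d X Q) (h m) 0 k) (sharp d Q (h (m + p)) 0 k)
  (sharp d T (h m.+1) 0 k) (sharp d P (h (m + p).+1) 0 k) => y q t r E1 E2 E3.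
(* The three relations combine linearly after clearing the factor of [PQ] at [m + p]. *)
apply: (mulfI (natr_neq0 (m + p))); apply/eqP; rewrite -subr_eq0; apply/eqP.
rewrite [LHS](_ : _ =
   (m + p).+1%:R * (m.+2%:R * (y + m.+1%:R * q) - m.+1%:R * (e * t + m.+2%:R * r))
   - m.+1%:R * m.+2%:R * ((m + p).+2%:R * q - (m + p).+1%:R * r)
   - m.+1%:R * ((m + p).+1%:R * t - m.+2%:R * q)); last by ring.
by rewrite E1 E2 E3 !subrr !mulr0 !subr0.
Qed.

(** * Modular fields and master symmetries *)

Definition prod_a : A := \prod_(i < N.-1) a i.+1.
Local Notation pa := prod_a.

Lemma partial_aa (i : 'I_N.-1) j : d (lshift N i) (a j) = (j == i.+1)%:R.
Proof.
case: flaschka_aP => [k ->|jN].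
  by rewrite dx (inj_eq (@lshift_inj _ _)) eqSS eq_sym.
rewrite (der0 (dd _)); case: eqP => // ji; have := ltn_ord i; lia.
Qed.

Lemma partial_ab (i : 'I_N.-1) j : d (lshift N i) (b j) = 0.
Proof. by case: flaschka_bP => [k _|_]; rewrite ?(der0 (dd _))// dx eq_lrshift. Qed.

Lemma partial_ba (i : 'I_N) j : d (rshift N.-1 i) (a j) = 0.
Proof. by case: flaschka_aP => [k _|_]; rewrite ?(der0 (dd _))// dx eq_rlshift. Qed.

Lemma partial_bb (i : 'I_N) j : d (rshift N.-1 i) (b j) = (j == i.+1)%:R.
Proof.
case: flaschka_bP => [k ->|jN].
  by rewrite dx (inj_eq (@rshift_inj _ _)) eqSS eq_sym.
rewrite (der0 (dd _)); case: eqP => // ji; have := ltn_ord i; lia.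
Qed.

Lemma partial_a_bsum (i : 'I_N.-1) j : d (lshift N i) (bsum j) = 0.
Proof. by rewrite (der_sum (dd _)) big1// => k _; rewrite partial_ab. Qed.

Lemma partial_b_bsum (i : 'I_N) j : (j <= i.+1)%N -> d (rshift N.-1 i) (bsum j) = 0.
Proof.
move=> ji; rewrite (der_sum (dd _)) big_nat_cond big1// => k; rewrite andbT => kj.
by rewrite partial_bb; case: eqP => //; lia.
Qed.

(** Logarithmic derivative of [a i] along the master symmetry. *)
Definition log_X1 i : A := - i%:R * b i + (i%:R + 2) * b i.+1.

Definition log_X2 i : A :=
  (2 - i%:R) * a i.-1 ^+ 2 + (1 - i%:R) * b i ^+ 2 + b i * b i.+1
  + (i%:R + 1) * a i.+1 ^+ 2 + (i%:R + 1) * b i.+1 ^+ 2 + a i ^+ 2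
  + bsum i * (b i.+1 - b i).

Definition sum_log (phi : nat -> A) : A := \sum_(i < N.-1) phi i.+1.

Lemma X1_prod_a : D1 pa = pa * sum_log log_X1.
Proof.
apply: (der_prod_log (vf_app_der dd _)) => i.
by rewrite app_X1_a /toda_X1_a /log_X1; ring.
Qed.

Lemma X2_prod_a : D2 pa = pa * sum_log log_X2.
Proof.
apply: (der_prod_log (vf_app_der dd _)) => i.
by rewrite app_X2_a /toda_X2_a /log_X2; ring.
Qed.

Lemma divergenceE (Xa Xb : nat -> A) :
  divergence d (row_mx (\row_(i < N.-1) Xa i.+1) (\row_(i < N) Xb i.+1)) =
  \sum_(i < N.-1) d (lshift N i) (Xa i.+1)
  + \sum_(i < N) d (rshift N.-1 i) (Xb i.+1).
Proof.
by rewrite /divergence big_split_ord; congr (_ + _);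
  apply: eq_bigr => i _; rewrite ?row_mxEl ?row_mxEr mxE.
Qed.

Lemma jacobi_trace0 : h 0 = \sum_(i < N) b i.+1.
Proof.
rewrite /h expr1; apply: eq_bigr => i _; rewrite mxE /jacobi_coef.
by decide_eqs; ring.
Qed.

Lemma jacobi_trace1 : h 1 = \sum_(i < N) (a i ^+ 2 + b i.+1 ^+ 2 + a i.+1 ^+ 2).
Proof.
rewrite /h expr2 -mulmxE mul_jacobi_mx; apply: eq_bigr => i _.
rewrite mxE /jacobi_l /jacobi_coef /=.
by decide_eqs; ring.
Qed.

Let derXd k := derX (dd k).
Let derDd k := derD (dd k).
Let derBd k := derB (dd k).
Let derNd k := derN (dd k).
Let derMd k := derM (dd k).
Let dernd k := der_nat (dd k).
Let der1d k := der1 (dd k).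
Let dE := (derXd, derBd, derDd, derNd, derMd, dernd, der1d).

(** The terms of the divergence that come from the [a i] cancel the logarithmic
derivative exactly, whatever their dependence on [i]. *)
Lemma div_X1 : sum_log log_X1 - divergence d toda_X1 = - 2 * h 0.
Proof.
rewrite divergenceE jacobi_trace0 opprD addrA.
have -> : \sum_(i < N.-1) d (lshift N i) (toda_X1_a i.+1) = sum_log log_X1.
  apply: eq_bigr => i _; rewrite /toda_X1_a !dE !partial_ab !partial_aa eqxx /= /log_X1; ring.
rewrite subrr add0r mulr_sumr -sumrN; apply: eq_bigr => i _.
by rewrite /toda_X1_b !dE !partial_ba partial_bb eqxx /=; ring.
Qed.

(** The coefficients depending on [i] telescope, leaving [3 \tr (L ^+ 2)]. *)
Lemma div_X2 : sum_log log_X2 - divergence d toda_X2 = - 3 * h 1.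
Proof.
rewrite divergenceE jacobi_trace1.
have -> : \sum_(i < N.-1) d (lshift N i) (toda_X2_a i.+1) =
    sum_log log_X2 + \sum_(i < N) 2 * a i.+1 ^+ 2.
  have -> : \sum_(i < N) 2 * a i.+1 ^+ 2 = \sum_(i < N.-1) 2 * a i.+1 ^+ 2.
    apply: (@sum_ord_pred _ N (fun l => 2 * a l ^+ 2)).
    by rewrite flaschka_a_out ?leqnn ?orbT// expr0n mulr0.
  rewrite -big_split; apply: eq_bigr => i _.
  rewrite /toda_X2_a /log_X2 !dE !partial_ab !partial_aa !partial_a_bsum /=; decide_eqs; ring.
have -> : \sum_(i < N) d (rshift N.-1 i) (toda_X2_b i.+1) = \sum_(i < N)
    ((2 * i.+1%:R + 2) * a i.+1 ^+ 2 + (4 - 2 * i.+1%:R) * a i ^+ 2 + 3 * b i.+1 ^+ 2).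
  apply: eq_bigr => i _.
  rewrite /toda_X2_b /= !dE !partial_ba !partial_bb !partial_b_bsum ?leqnSn ?leqnn//.
  by decide_eqs; ring.
(* [2 i + 1] is the primitive matching the coefficients of [a i ^+ 2] left over. *)
have tele : \sum_(i < N) ((2 * i.+1%:R + 1) * a i.+1 ^+ 2 - (2 * i%:R + 1) * a i ^+ 2) = 0.
  have tele m : \sum_(i < m) ((2 * i.+1%:R + 1) * a i.+1 ^+ 2
      - (2 * i%:R + 1) * a i ^+ 2) = (2 * m%:R + 1) * a m ^+ 2.
    elim: m => [|m IHm]; first by rewrite big_ord0 flaschka_a0; ring.
    by rewrite big_ord_recr IHm /=; ring.
  by rewrite tele flaschka_a_out ?leqnn ?orbT//; ring.
rewrite opprD addrA opprD addrA subrr add0r -[RHS]subr0 -[X in _ = _ - X]tele.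
rewrite mulr_sumr -!sumrB -opprD -big_split -sumrN; apply: eq_bigr => i _ /=.
by ring.
Qed.

Lemma curl_bracket P k : curl d P 0 k =
  \sum_(l < N.-1) d (lshift N l) (bracket d P (x k) (a l.+1))
  + \sum_(l < N) d (rshift N.-1 l) (bracket d P (x k) (b l.+1)).
Proof.
rewrite mxE big_split_ord /=; congr (_ + _); apply: eq_bigr => l _.
  by rewrite flaschka_aE bracket_coord.
by rewrite flaschka_bE bracket_coord.
Qed.

(** When the brackets with [a l] are multiples of [a l], the Hamiltonian field of the
logarithm of the product has the same components as the modular field, up to the
terms collected in the last hypothesis. *)
Lemma curl_sharp_prod P k (psi : nat -> A) :
    (forall l, bracket d P (x k) (a l) = a l * psi l) ->
    \sum_(l < N.-1) a l.+1 * d (lshift N l) (psi l.+1)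
    + \sum_(l < N) d (rshift N.-1 l) (bracket d P (x k) (b l.+1)) = 0 ->
  pa * curl d P 0 k = sharp d P pa 0 k.
Proof.
move=> Pa Pb; rewrite sharp_bracket.
have -> : bracket d P (x k) pa = pa * \sum_(l < N.-1) psi l.+1.
  by apply: (der_prod_log (bracket_derr dd P _)) => l; apply: Pa.
congr (_ * _).
rewrite curl_bracket -[RHS]addr0 -[X in _ = _ + X]Pb addrA -big_split.
congr (_ + _); apply: eq_bigr => l _ /=.
by rewrite Pa (derM (dd _)) partial_aa eqxx mul1r.
Qed.

Lemma curl_pi1 : pa *: curl d toda_pi1 = sharp d toda_pi1 pa.
Proof.
apply/rowP=> k; rewrite [LHS]mxE.
case: (split_ordP k) => {}k ->.
  apply: (@curl_sharp_prod _ _ (fun=> 0)); rewrite -?flaschka_aE.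
    by move=> l; rewrite bracket1_aa mulr0.
  rewrite !big1 ?addr0// => l _; last by rewrite (der0 (dd _)) mulr0.
  by rewrite bracket1_ab !dE partial_ba; ring.
apply: (@curl_sharp_prod _ _ (fun l => - ((k.+1 == l.+1)%:R - (k.+1 == l)%:R)));
  rewrite -?flaschka_bE.
  by move=> l; rewrite bracket1_ba; ring.
rewrite !big1 ?addr0// => l _; last by rewrite !dE; ring.
by rewrite bracket1_bb (der0 (dd _)).
Qed.

Lemma curl_pi2 : pa *: curl d toda_pi2 = sharp d toda_pi2 pa.
Proof.
apply/rowP=> k; rewrite [LHS]mxE.
have dhalf k' := der_half (dd k').
case: (split_ordP k) => {}k ->.
  apply: (@curl_sharp_prod _ _ 
    (fun l => half * a k.+1 * ((l == k.+2)%:R - (k.+1 == l.+1)%:R)));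
  rewrite -?flaschka_aE.
    by move=> l; rewrite bracket2_aa; ring.
  rewrite big1 ?add0r; last first.
    move=> l _; rewrite !dE dhalf partial_aa !eqSS.
    by case: (nat_of_ord k =P l) => [->|_] /=; decide_eqs; ring.
  transitivity (\sum_(l < N) (l.+1 == k.+2)%:R * a k.+1
    - \sum_(l < N) (l.+1 == k.+1)%:R * a k.+1).
    rewrite -sumrB; apply: eq_bigr => l _.
    by rewrite bracket2_ab !dE partial_ba partial_bb eqxx /=; ring.
  rewrite (@sum_delta k.+2 (fun=> a k.+1)).
    by rewrite (@sum_delta k.+1 (fun=> a k.+1)) ?subrr// => ?; have := ltn_ord k; lia.
  by move=> ?; have := ltn_ord k; lia.
apply: (@curl_sharp_prod _ _ (fun l => - (b k.+1 * ((k.+1 == l.+1)%:R - (k.+1 == l)%:R))));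
  rewrite -?flaschka_bE.
  by move=> l; rewrite bracket2_ba; ring.
rewrite !big1 ?addr0// => l _; last by rewrite !dE partial_ab; ring.
by rewrite bracket2_bb !dE !partial_ba; ring.
Qed.

Lemma sharp_pi1_trace : sharp d toda_pi1 (h 0) = 0.
Proof.
apply/rowP=> k; rewrite sharp_bracket jacobi_trace0 mxE.
rewrite (der_sum (bracket_derr dd _ _)).
case: (split_ordP k) => {}k ->; rewrite -?flaschka_aE -?flaschka_bE; last first.
  by rewrite big1// => l _; rewrite bracket1_bb.
transitivity (\sum_(l < N) (l.+1 == k.+2)%:R * a k.+1
    - \sum_(l < N) (l.+1 == k.+1)%:R * a k.+1).
  rewrite -sumrB; apply: eq_bigr => l _.
  by rewrite bracket1_ab; ring.
rewrite (@sum_delta k.+2 (fun=> a k.+1)).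
  by rewrite (@sum_delta k.+1 (fun=> a k.+1)) ?subrr// => ?; have := ltn_ord k; lia.
by move=> ?; have := ltn_ord k; lia.
Qed.

(** The modular field of a Lie derivative, in the form used for the induction. Dividing by
[prod_a], the hypothesis is [Y = P f + Z] for the logarithm [f] of [prod_a]; both
[f] and the volume are moved by [X], which leaves [phi - div X]. *)
Lemma curl_lie_prod X P Z phi : P^T = - P -> vf_app d X pa = pa * phi ->
    pa *: curl d P = sharp d P pa + pa *: Z ->
  pa *: curl d (lie_bv d X P) = sharp d (lie_bv d X P) pa
    + pa *: (sharp d P (phi - divergence d X) + lie_vf d X Z).
Proof.
move=> Pa Xpa PZ; rewrite (curl_lie dd dC) //; last exact: addr2_eq0.
have := congr1 (lie_vf d X) PZ.
rewrite (lie_vfDr dd) !(lie_vfZr dd) (lie_vf_sharp dd dC) Xpa (sharpM dd).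
move=> /rowP E; apply/rowP=> k; move: (E k) => {E}.
have /rowP/(_ k) := PZ.
rewrite (sharpD dd) (sharpN dd) !(mxZE, mxDE, mxNE).
set c := curl d P 0 k; set lc := lie_vf d X (curl d P) 0 k.
set s1 := sharp d (lie_bv d X P) pa 0 k; set s2 := sharp d P phi 0 k.
set s3 := sharp d P pa 0 k; set s4 := sharp d P (divergence d X) 0 k.
set z := Z 0 k; set lz := lie_vf d X Z 0 k => E1 E2.
apply/eqP; rewrite -subr_eq0; apply/eqP.
rewrite [LHS](_ : _ = (pa * phi * c + pa * lc
     - (s1 + (pa * s2 + phi * s3) + (pa * phi * z + pa * lz)))
  - phi * (pa * c - (s3 + pa * z))); last by ring.
by rewrite E1 E2 !subrr mulr0 subr0.
Qed.

(** * The Lenard relation for the determinant *)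

Let dmap i := map_mx (d i) L.

(** The Lenard relation on matrices: it is linear in [L ^+ m], so it extends to
combinations of powers whose coefficients are functions. *)
Lemma lenard_pow P Q : lenard P Q -> forall m k,
  \sum_i Q k i * \tr (L ^+ m *m dmap i) = \sum_i P k i * \tr (L ^+ m.+1 *m dmap i).
Proof.
move=> PQ m k; have /rowP/(_ k) := PQ m.
rewrite !mxZE [X in _ * X = _]mxE [X in _ = _ * X]mxE.
under eq_bigr do rewrite (der_mxtraceX (dd _)) mulrCA.
under [in RHS]eq_bigr do rewrite (der_mxtraceX (dd _)) mulrCA.
rewrite -!mulr_sumr mulrCA => /(mulfI (natr_neq0 m)) /(mulfI (natr_neq0 m.+1)).
by [].
Qed.

(** The Lenard relation for [H_0 = \ln (\det L)]. The differential of the determinant is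
the trace of [\adj L] against that of [L], the adjugate is a combination of powers of
[L], and [\adj L *m L] is scalar. *)
Lemma lenard_det P Q : \det L != 0 -> lenard P Q ->
  sharp d Q (\det L) = \det L *: sharp d P (h 0).
Proof.
move=> detL PQ; have [q adjL] := adj_poly_mx detL; apply/rowP=> k.
rewrite mxE mxZE [X in _ = _ * X]mxE.
transitivity (\sum_i P k i * \tr (\adj L *m L *m dmap i)).
  under eq_bigr do rewrite (der_det (dd _)) adjL mulmx_suml linear_sum mulr_sumr.
  under [RHS]eq_bigr do rewrite adjL !mulmx_suml linear_sum mulr_sumr.
  rewrite exchange_big [RHS]exchange_big; apply: eq_bigr => l _ /=.
  under eq_bigr do rewrite -scalemxAl linearZ /= mulrCA.
  under [RHS]eq_bigr do rewrite -!scalemxAl linearZ /= mulrCA mulmxE -exprSr.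
  by rewrite -!mulr_sumr (lenard_pow PQ).
rewrite mulr_sumr; apply: eq_bigr => i _.
rewrite mul_adj_mx mul_scalar_mx linearZ /= mulrCA; congr (_ * (_ * _)).
by rewrite /h expr1 (der_mxtrace (dd i)).
Qed.

(** * The whole hierarchy *)

Section Hierarchy.
Variable P : nat -> 'M[A]_n.
Hypothesis P0 : P 0 = 0.
Hypothesis P1 : P 1 = toda_pi1.
Hypothesis P2 : P 2 = toda_pi2.
Hypothesis P3 : P 3 = - lie_bv d toda_X1 (P 2).
Hypothesis P4 : 2 *: P 4 = - lie_bv d toda_X2 (P 2).
Hypothesis PS : forall j, j.+1%:R *: P j.+4.+1 = lie_bv d toda_X1 (P j.+4).

Let shZ c Q u : sharp d (c *: Q) u = c *: sharp d Q u.
Proof. exact: sharpZl. Qed.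
Let shN Q u : sharp d (- Q) u = - sharp d Q u.
Proof. by rewrite -scaleN1r shZ scaleN1r. Qed.

Lemma scale_natI m (u v : 'rV[A]_n) : m.+1%:R *: u = m.+1%:R *: v -> u = v.
Proof.
move=> /rowP uv; apply/rowP=> k; apply: (mulfI (natr_neq0 m)).
by have := uv k; rewrite !mxE.
Qed.

Lemma hierarchy_lie_X1 j m : lenard (P j) (P j.+1) ->
    (forall m, sharp d (lie_bv d toda_X1 (P j)) (h m) =
               (j%:R - 3) *: sharp d (P j.+1) (h m)) ->
  m.+2%:R *: sharp d (lie_bv d toda_X1 (P j.+1)) (h m) =
   (m.+1%:R * (j%:R - 2)) *: sharp d (P j.+1) (h m.+1).
Proof.
move=> PQ XP.
rewrite (@lenard_lie toda_X1 (P j) (P j.+1) (P j.+1) (j%:R - 3) 1)//.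
- by congr (_ *: _); ring.
- by move=> {}m; rewrite X1_trace addn1.
- by move=> {}m; rewrite addn1.
Qed.

(** The relation at [j] is the derivative along [X1] of the relation at [j - 1], except at
[j = 3], where that derivative says only that [L_(X1) pi_3] kills the differentials of
traces; the relation between [pi_3] and [pi_4] is the derivative along [X2] of that
between [pi_1] and [pi_2]. *)
Lemma lenard_hierarchy j : (0 < j)%N -> lenard (P j) (P j.+1) /\
  (forall m, sharp d (lie_bv d toda_X1 (P j)) (h m) = (j%:R - 3) *: sharp d (P j.+1) (h m)).
Proof.
have L1 : lenard (P 1) (P 2) by rewrite P1 P2; apply: lenard_pi12.
have E1 m : sharp d (lie_bv d toda_X1 (P 1)) (h m) = (1 - 3) *: sharp d (P 2) (h m).
  by rewrite P1 P2 lie_X1_pi1 shZ; congr (_ *: _); ring.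
have E2 m : sharp d (lie_bv d toda_X1 (P 2)) (h m) = (2 - 3) *: sharp d (P 3) (h m).
  rewrite P3 shN scalerN -scaleNr (_ : - (2 - 3) = 1 :> A) ?scale1r//; ring.
have L2 : lenard (P 2) (P 3).
  move=> m; rewrite P3 shN scalerN (@hierarchy_lie_X1 1)//.
  by rewrite -scaleNr; congr (_ *: _); ring.
(* This is not a consequence of the recursion: the next tensor does not come from [X1]. *)
have E3 m : sharp d (lie_bv d toda_X1 (P 3)) (h m) = (3 - 3) *: sharp d (P 4) (h m).
  rewrite subrr scale0r; apply: (@scale_natI m.+1).
  by rewrite (@hierarchy_lie_X1 2)// subrr mulr0 !scale0r scaler0.
(* [- 3] and [2] are the multiplier of [L_(X2) pi_1 = - 3 pi_3] and the degree of [X2]. *)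
have L3 : lenard (P 3) (P 4).
  move=> m; apply: (@scale_natI 1).
  rewrite scalerA mulrC -scalerA -[2 *: sharp d (P 4) _]shZ P4 shN scalerN.
  rewrite (@lenard_lie toda_X2 (P 1) (P 2) (P 3) (- 3) 2)//.
  - by rewrite scalerA -scaleNr; congr (_ *: _); ring.
  - by move=> {}m; rewrite X2_trace addn2.
  - move=> {}m; rewrite P1 lie_X2_pi1 -P2 shZ P3 shN scalerN scaleNr opprK//.
  - by move=> {}m; rewrite addn2 (L2 m.+1).
have E4 i m : sharp d (lie_bv d toda_X1 (P i.+4)) (h m) =
    (i.+4%:R - 3) *: sharp d (P i.+4.+1) (h m).
  by rewrite -PS shZ; congr (_ *: _); ring.
have L4 i : lenard (P i.+3) (P i.+4).
  elim: i => [//|i IHi] m; apply: (@scale_natI i).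
  rewrite scalerA mulrC -scalerA -[_ *: sharp d (P i.+4.+1) _]shZ PS.
  rewrite (@hierarchy_lie_X1 i.+3)//; last by case: i {IHi}.
  by rewrite scalerA; congr (_ *: _); ring.
by case: j => [//|[|[|[|j]]]] _.
Qed.

Lemma asym_natZ m (Q : 'M[A]_n) : (m.+1%:R *: Q)^T = - (m.+1%:R *: Q) -> Q^T = - Q.
Proof.
move=> /matrixP Qa; apply/matrixP=> i k; apply: (mulfI (natr_neq0 m)).
by have := Qa i k; rewrite !mxE mulrN.
Qed.

Lemma hierarchy_asym j : (P j)^T = - P j.
Proof.
have lieN X Q : Q^T = - Q -> (- lie_bv d X Q)^T = - - lie_bv d X Q.
  by move=> Qa; rewrite linearN /= (lie_bv_asym dd).
have P2a : (P 2)^T = - P 2 by rewrite P2; apply: toda_pi2_asym.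
case: j => [|[|[|[|j]]]]; first by rewrite P0 trmx0 oppr0.
- by rewrite P1; apply: toda_pi1_asym.
- by [].
- by rewrite P3; apply: lieN.
elim: j => [|j IHj]; first by apply: (@asym_natZ 1); rewrite P4; apply: lieN.
by apply: (@asym_natZ j); rewrite PS; apply: (lie_bv_asym dd).
Qed.

(** The induction step needs [X1 f - div X1 = - 2 \tr L] and the Lie derivative of
[P_(j-1) (\tr L)], which is [(j - 2) P_j (\tr L)] by the Lenard relations; the factor
[j - 3] of the recursion comes out of [(j - 1) (j - 2) - 2 = j (j - 3)]. *)
Lemma modular_hierarchy j : (0 < j)%N ->
  pa *: curl d (P j) = sharp d (P j) pa
    + pa *: ((j%:R - 1) *: sharp d (P j.-1) (h 0)).
Proof.
have M2 : pa *: curl d (P 2) = sharp d (P 2) pa + pa *: 0.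
  by rewrite scaler0 addr0 P2 curl_pi2.
have lie20 X : lie_vf d X (0 : 'rV[A]_n) = 0.
  by rewrite -(scale0r 0) (lie_vfZr dd) (der0 (vf_app_der dd _)) !scale0r addr0.
case: j => [//|[_|[_|[_|]]]].
- by rewrite subrr scale0r scaler0 addr0 P1 curl_pi1.
- by rewrite M2 P1 sharp_pi1_trace !scaler0.
- rewrite P3 (curlN dd) scalerN shN.
  rewrite (curl_lie_prod (hierarchy_asym 2) X1_prod_a M2).
  rewrite div_X1 lie20 addr0 opprD; congr (_ + _).
  rewrite -scalerN mulNr (sharpN dd) opprK (sharp_natM dd).
  by congr (_ *: (_ *: _)); ring.
elim=> [|j IHj] _.
  apply: (@scale_natI 1).
  rewrite scalerDr -shZ P4 shN [LHS]scalerA [2 * pa]mulrC -scalerA.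
  rewrite -(curl_natZ dd) P4 (curlN dd) scalerN.
  rewrite (curl_lie_prod (hierarchy_asym 2) X2_prod_a M2).
  rewrite div_X2 lie20 addr0 opprD; congr (_ + _).
  rewrite -scalerN mulNr (sharpN dd) opprK (sharp_natM dd).
  have [L2 _] := lenard_hierarchy (isT : 0 < 2)%N; have := L2 0%N; rewrite scale1r => <-.
  rewrite !scalerA; congr (_ *: _); ring.
have {}IHj := IHj isT.
apply: (@scale_natI j).
rewrite scalerDr -shZ PS [LHS]scalerA [_ * pa]mulrC -scalerA -(curl_natZ dd) PS.
rewrite (curl_lie_prod (hierarchy_asym _) X1_prod_a IHj).
congr (_ + _); rewrite [RHS]scalerA [_ * pa]mulrC -scalerA; congr (_ *: _).
have [L3 E3] := lenard_hierarchy (isT : 0 < j.+3)%N.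
have -> : (j.+4%:R - 1 : A) = j.+3%:R by ring.
rewrite div_X1 mulNr (sharpN dd) (sharp_natM dd) (lie_vfZr dd).
rewrite (der_nat (vf_app_der dd _)) scale0r add0r (lie_vf_sharp dd dC) E3.
rewrite X1_trace mul1r.
have := L3 0%N; rewrite scale1r => <-.
rewrite -scaleNr -scalerDl scalerA -scalerDl [RHS]scalerA; congr (_ *: _).
ring.
Qed.

End Hierarchy.
End Flaschka.

(** * Polynomials as functions *)

Import -(notations) mpoly.

Section PolynomialFunctions.
Variables (R : realType) (n : nat).
Local Notation A := (mpoly n R).
Implicit Types (p q : A) (y : 'rV[R]_n).

Definition point_eval y : A -> R := meval (fun i => y 0 i).

HB.instance Definition _ y := GRing.RMorphism.on (point_eval y).

(** Restricts to a line, where the one-variable rules for products, compositions and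
the logarithm apply. *)
Lemma pderivE k (h : 'rV[R]_n -> R) y :
  pderiv k h y = 'D_1 (fun t : R => h (t *: delta_mx 0 k + y)) (0 : R).
Proof.
rewrite /pderiv /derive.
set f := (fun _ => _ : R^o); set g := (fun _ => _).
suff -> : f = g by [].
apply/funext => t; rewrite /f /g /=.
by rewrite scale0r add0r /GRing.scale /= mulr1 addr0.
Qed.

Lemma is_derive_mpoly k p y : is_derive (0 : R) 1
  (fun t : R => point_eval (t *: delta_mx 0 k + y) p) (point_eval y (mderiv k p)).
Proof.
pose S q := is_derive (0 : R) 1
  (fun t : R => point_eval (t *: delta_mx 0 k + y) q) (point_eval y (mderiv k q)).
have SC c : S (mpolyC n c).
  rewrite /S mderivC rmorph0.
  rewrite (_ : (fun t => _) = cst c); first exact: is_derive_cst.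
  by apply/funext=> t; rewrite /point_eval mevalC.
have SD q r : S q -> S r -> S (q + r).
  move=> Sq Sr; rewrite /S mderivD rmorphD.
  rewrite (_ : (fun t => _) = (fun t => point_eval (t *: delta_mx 0 k + y) q)
     + (fun t => point_eval (t *: delta_mx 0 k + y) r)); first exact: is_deriveD.
  by apply/funext=> t; rewrite rmorphD.
have SM q r : S q -> S r -> S (q * r).
  move=> Sq Sr; rewrite /S mderivM rmorphD !rmorphM.
  rewrite (_ : (fun t => _) = (fun t => point_eval (t *: delta_mx 0 k + y) q)
     * (fun t => point_eval (t *: delta_mx 0 k + y) r)); last first.
    by apply/funext=> t; rewrite rmorphM.
  apply: is_derive_eq (is_deriveM Sq Sr) _.
  by rewrite !scale0r !add0r /GRing.scale /= addrC mulrC.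
have SX i : S (mpolyX R (mnm1 i)).
  rewrite /S.
  have -> : point_eval y (mderiv k (mpolyX R (mnm1 i))) = (delta_mx 0 k : 'rV[R]_n) 0 i.
    rewrite mderivX mnm1E mxE eqxx /=.
    case: (eqVneq i k) => [->|ik].
      by rewrite scale1r -{1}[mnm1 k]add0m addmK mpolyX0 rmorph1.
    by rewrite scale0r rmorph0.
  set c := (delta_mx 0 k : 'rV[R]_n) 0 i.
  rewrite (_ : (fun t => _) = (fun t : R => t) * cst c + cst (y 0 i)); last first.
    by apply/funext=> t; rewrite /point_eval mevalXU !mxE /c mxE.
  apply: is_derive_eq.
  by rewrite /GRing.scale /=; ring.
move: p; apply: (@mpolyind n R S) => [|c m q _ _ Sq].
  by rewrite -(mpolyC0 n R); apply: (SC).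
apply: SD Sq; rewrite -mul_mpolyC; apply: (SM); first exact: (SC).
have S1 : S 1 by rewrite -(mpolyC1 n R); apply: (SC).
have SP I (r : seq I) (F : I -> A) : (forall i, S (F i)) -> S (\prod_(i <- r) F i).
  move=> SF; elim: r => [|i r IHr]; first by rewrite big_nil.
  by rewrite big_cons; apply: (SM).
rewrite mpolyXE_id; apply: SP => i.
by elim: (m i) => [|l IHl]; rewrite ?expr0// exprS; apply: (SM).
Qed.

Lemma pderiv_mpoly k p y :
  pderiv k (fun z => point_eval z p) y = point_eval y (mderiv k p).
Proof. by rewrite pderivE; apply: (@derive_val _ _ _ _ _ _ _ (is_derive_mpoly k p y)). Qed.

Lemma pderiv_ln_mpoly k p q c y : 0 < point_eval y p -> 0 < point_eval y q ->
  pderiv k (fun z => ln (point_eval z p) + c * ln (point_eval z q)) y =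
  point_eval y (mderiv k p) / point_eval y p
  + c * (point_eval y (mderiv k q) / point_eval y q).
Proof.
have line0 : (0 : R) *: delta_mx 0 k + y = y by rewrite scale0r add0r.
have der_ln r : 0 < point_eval y r -> is_derive (0 : R) 1
    (@ln R \o (fun t : R => point_eval (t *: delta_mx 0 k + y) r))
    ((point_eval y r)^-1 * point_eval y (mderiv k r)).
  move=> r0; apply: is_derive1_comp; last exact: is_derive_mpoly.
  by rewrite line0; apply: is_derive1_ln.
move=> p0 q0; rewrite pderivE.
have dp := der_ln p p0.
have dq := der_ln q q0.
rewrite (_ : (fun t => _) = (@ln R \o (fun t : R => point_eval (t *: delta_mx 0 k + y) p))
  + c \*: (@ln R \o (fun t : R => point_eval (t *: delta_mx 0 k + y) q)))//.
rewrite derive_val /GRing.scale /=; ring.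
Qed.

Lemma lie_derivative_mpoly (X : 'rV[A]_n) (P : 'M[A]_n) y :
  lie_derivative (fun z => map_mx (point_eval z) X) (fun z => map_mx (point_eval z) P) y =
  map_mx (point_eval y) (lie_bv (@mderiv n R) X P).
Proof.
have entryE r s (M : 'M[A]_(r, s)) i j :
    (fun z => map_mx (point_eval z) M i j) = (fun z => point_eval z (M i j)).
  by apply/funext=> z; rewrite mxE.
apply/matrixP=> i j; rewrite !mxE rmorph_sum; apply: eq_bigr => k _.
by rewrite !entryE !pderiv_mpoly !mxE !rmorphB !rmorphM.
Qed.

Lemma modular_field_mpoly (P : 'M[A]_n) y :
  modular_field (fun z => map_mx (point_eval z) P) y =
  map_mx (point_eval y) (curl (@mderiv n R) P).
Proof.
apply/rowP=> k; rewrite !mxE rmorph_sum; apply: eq_bigr => i _.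
rewrite /= -pderiv_mpoly; congr pderiv.
by apply/funext=> z; rewrite mxE.
Qed.

Lemma hamiltonian_field_mpoly (P : 'M[A]_n) p q c y :
    0 < point_eval y p -> 0 < point_eval y q ->
  hamiltonian_field (fun z => map_mx (point_eval z) P)
    (fun z => ln (point_eval z p) + c * ln (point_eval z q)) y =
  (point_eval y p)^-1 *: map_mx (point_eval y) (sharp (@mderiv n R) P p)
  + (c / point_eval y q) *: map_mx (point_eval y) (sharp (@mderiv n R) P q).
Proof.
move=> p0 q0; apply/rowP=> k; rewrite !mxE !rmorph_sum !mulr_sumr -big_split.
apply: eq_bigr => i _ /=; rewrite !mxE pderiv_ln_mpoly// !rmorphM /=; ring.
Qed.

End PolynomialFunctions.

(** * Evaluation of the Toda hierarchy *)

Lemma scale_inv (K : idomainType) m (M : 'M[K]_m) (c e : K) :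
  c * e = 1 -> c *: (e *: M) = M.
Proof. by move=> ce; rewrite scalerA ce scale1r. Qed.

Lemma scaleN_inv (K : idomainType) m (M : 'M[K]_m) (c e : K) :
  c * e = 1 -> c *: - (e *: M) = - M.
Proof. by move=> ce; rewrite scalerN scale_inv. Qed.

#[local] Arguments flaschka_a : simpl never.
#[local] Arguments flaschka_b : simpl never.
#[local] Arguments acoord : simpl never.
#[local] Arguments bcoord : simpl never.

Section TodaPolynomials.
Variables (R : realType) (N : nat).
Local Notation n := (N.-1 + N)%N.
Local Notation A := (mpoly n R).
Local Notation d := (@mderiv n R).
Implicit Types (y : 'rV[R]_n).

Definition coord_poly (k : 'I_n) : A := mpolyX R (mnm1 k).
Local Notation x := coord_poly.
Local Notation half := (mpolyC n (2^-1 : R)).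

(** The recursion of [toda_tensor], on polynomials. *)
Fixpoint toda_poly (j : nat) : 'M[A]_n :=
  match j with
  | 0 => 0
  | 1 => toda_pi1 x
  | 2 => toda_pi2 x half
  | 3 => - lie_bv d (toda_X1 x) (toda_pi2 x half)
  | 4 => - (half *: lie_bv d (toda_X2 x) (toda_pi2 x half))
  | j'.+1 => mpolyC n (j'%:R - 3)^-1 *: lie_bv d (toda_X1 x) (toda_poly j')
  end.

Lemma point_evalC y c : point_eval y (mpolyC n c) = c.
Proof. exact: mevalC. Qed.

Lemma acoord_eval y i : point_eval y (flaschka_a x i) = acoord i y.
Proof.
case: i => [|i]; first by rewrite rmorph0.
rewrite /flaschka_a /acoord; case: insubP => [k _ _|_] /=; last by rewrite rmorph0.
exact: mevalXU.
Qed.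

Lemma bcoord_eval y i : point_eval y (flaschka_b x i) = bcoord i y.
Proof.
case: i => [|i]; first by rewrite rmorph0.
rewrite /flaschka_b /bcoord; case: insubP => [k _ _|_] /=; last by rewrite rmorph0.
exact: mevalXU.
Qed.

Let evD y p q : point_eval y (p + q) = point_eval y p + point_eval y q.
Proof. exact: rmorphD. Qed.
Let evN y p : point_eval y (- p) = - point_eval y p.
Proof. exact: rmorphN. Qed.
Let evM y p q : point_eval y (p * q) = point_eval y p * point_eval y q.
Proof. exact: rmorphM. Qed.
Let evX y p m : point_eval y (p ^+ m) = point_eval y p ^+ m.
Proof. exact: rmorphXn. Qed.
Let ev_nat y m : point_eval y m%:R = m%:R.
Proof. exact: rmorph_nat. Qed.
Let ev0 y : point_eval y 0 = 0 :> R.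
Proof. exact: rmorph0. Qed.
Let ev1 y : point_eval y 1 = 1 :> R.
Proof. exact: rmorph1. Qed.
Let evE := (ev0, ev1, evD, evN, evM, evX, ev_nat, acoord_eval, bcoord_eval, point_evalC).

Lemma pi1_eval y : map_mx (point_eval y) (toda_pi1 x) = pi1 y.
Proof.
rewrite map_block_mx !raddf0 map_mxN -map_trmx.
have -> : map_mx (point_eval y) (toda_pi1_ab x) = pi1_ab y; last by [].
by apply/matrixP=> i k; rewrite !mxE /=; case: ifP => _; [|case: ifP => _]; rewrite !evE.
Qed.

Lemma pi2_eval y : map_mx (point_eval y) (toda_pi2 x half) = pi2 y.
Proof.
rewrite map_block_mx map_mxN -map_trmx; congr (block_mx _ _ (- _^T) _);
  by apply/matrixP=> i k; rewrite !mxE /=; case: ifP => _; [|case: ifP => _]; rewrite !evE.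
Qed.

Lemma X1_eval y : map_mx (point_eval y) (toda_X1 x) = X1 y.
Proof.
rewrite map_row_mx; congr row_mx; apply/rowP=> i; rewrite !mxE.
  by rewrite /toda_X1_a !evE.
by rewrite /toda_X1_b !evE.
Qed.

Lemma X2_eval y : map_mx (point_eval y) (toda_X2 x) = X2 y.
Proof.
have bsumE i : point_eval y (bsum x i) = \sum_(1 <= k < i) bcoord k y.
  by rewrite rmorph_sum; apply: eq_bigr => k _; rewrite /= bcoord_eval.
rewrite map_row_mx; congr row_mx; apply/rowP=> i; rewrite !mxE.
  by rewrite /toda_X2_a !evE bsumE.
by rewrite /toda_X2_b !evE !bsumE.
Qed.

Lemma jacobi_eval y : map_mx (point_eval y) (flaschka_jacobi x) = jacobi_mx y.
Proof.
apply/matrixP=> i k; rewrite !mxE /jacobi_coef !evE !eqSS -val_eqE.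
case: eqP => [->|ik] /=.
  by rewrite (ltn_eqF (ltnSn k)) /=; ring.
case: eqP => [->|_] /=; last by case: eqP => _ /=; ring.
by rewrite (ltn_eqF (ltnW (ltnSn _))) /=; ring.
Qed.

Lemma toda_tensor_eval j : @toda_tensor R N j =
  (fun y => map_mx (point_eval y) (toda_poly j)).
Proof.
have X1E : (@X1 R N) = (fun y => map_mx (point_eval y) (toda_X1 x)).
  by apply/funext=> y; rewrite X1_eval.
have X2E : (@X2 R N) = (fun y => map_mx (point_eval y) (toda_X2 x)).
  by apply/funext=> y; rewrite X2_eval.
have p2E : (@pi2 R N) = (fun y => map_mx (point_eval y) (toda_pi2 x half)).
  by apply/funext=> y; rewrite pi2_eval.
apply/funext; case: j => [|[|[|[|j]]]] y.
- by rewrite /= raddf0.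
- by rewrite /= pi1_eval.
- by rewrite /= pi2_eval.
- by rewrite /= X1E p2E lie_derivative_mpoly map_mxN.
elim: j y => [|j IHj] y.
  by rewrite /= X2E p2E lie_derivative_mpoly map_mxN map_mxZ /= point_evalC.
rewrite -[LHS]/((j.+4%:R - 3)^-1 *: lie_derivative (@X1 R N) (toda_tensor j.+4) y).
rewrite -[toda_poly _]/(mpolyC n (j.+4%:R - 3)^-1 *: lie_bv d (toda_X1 x) (toda_poly j.+4)).
have -> : @toda_tensor R N j.+4 = fun y => map_mx (point_eval y) (toda_poly j.+4).
  by apply/funext.
by rewrite X1E lie_derivative_mpoly map_mxZ /= point_evalC.
Qed.

Lemma mderiv_derivation k : derivation (d k).
Proof. by split; [exact: mderivD|exact: mderivM]. Qed.

Lemma mderiv_coord i k : d i (x k) = (i == k)%:R.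
Proof.
rewrite /coord_poly mderivX mnm1E eq_sym; case: eqVneq => [->|_].
  by rewrite scale1r -{1}[mnm1 k]add0m addmK mpolyX0.
by rewrite scale0r.
Qed.

Lemma mpoly_char0 m : m.+1%:R != 0 :> A.
Proof. by rewrite -mpolyC_nat mpolyC_eq0 pnatr_eq0. Qed.

Lemma mpolyC_invl m (c : R) : c = m.+1%:R -> m.+1%:R * mpolyC n c^-1 = 1 :> A.
Proof.
by move=> ->; rewrite -mpolyC_nat -mpolyCM divff ?mpolyC1// pnatr_eq0.
Qed.

End TodaPolynomials.

Theorem theorem3 (R : realType) (N : nat) (hN : (2 <= N)%N)
    (j : nat) (hj : (1 <= j)%N) (x : 'rV[R]_(N.-1 + N))
    (ha : forall i : nat, (1 <= i < N)%N -> 0 < acoord i x)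
    (hL : 0 < \det (jacobi_mx x)) :
  modular_field (toda_tensor j) x =
  hamiltonian_field (toda_tensor j)
    (fun y => log_prod_a y + (j%:R - 1) * log_det_L y) x.
Proof.
set n := (N.-1 + N)%N in x ha hL *.
pose X := @coord_poly R N; pose half := mpolyC n (2^-1 : R).
pose P := @toda_poly R N; pose d := @mderiv n R.
have dd := @mderiv_derivation R N : forall k, derivation (d k).
have dC i k u : d i (d k u) = d k (d i u) by exact: mderiv_comm.
have dx := @mderiv_coord R N : forall i k, d i (X k) = (i == k)%:R.
have natr_neq0 := @mpoly_char0 R N.
have halfE : 2 * half = 1 by apply: (@mpolyC_invl R N 1).
have P3 : P 3 = - lie_bv d (toda_X1 X) (P 2) by [].
have P4 : 2 *: P 4 = - lie_bv d (toda_X2 X) (P 2).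
  exact: (scaleN_inv _ halfE).
have PS i : i.+1%:R *: P i.+4.+1 = lie_bv d (toda_X1 X) (P i.+4).
  by apply: (scale_inv _ (mpolyC_invl _ _)); ring.
have pa_eval y : point_eval y (prod_a X) = \prod_(1 <= i < N) acoord i y.
  rewrite rmorph_prod big_add1 big_mkord; apply: eq_bigr => i _.
  exact: acoord_eval.
have det_eval y : point_eval y (\det (flaschka_jacobi X)) = \det (jacobi_mx y).
  by rewrite -det_map_mx jacobi_eval.
have pa0 : 0 < point_eval x (prod_a X).
  rewrite pa_eval big_nat_cond prodr_gt0// => i; rewrite andbT => iN; exact: ha.
have det0 : 0 < point_eval x (\det (flaschka_jacobi X)) by rewrite det_eval.
have detN0 : \det (flaschka_jacobi X) != 0.
  by apply: contraTneq det0 => ->; rewrite rmorph0 ltxx.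
rewrite (toda_tensor_eval R N j) modular_field_mpoly.
rewrite (_ : (fun y => _ + _) = (fun y => ln (point_eval y (prod_a X))
    + (j%:R - 1) * ln (point_eval y (\det (flaschka_jacobi X))))); last first.
  by apply/funext=> y; rewrite /log_prod_a /log_det_L pa_eval det_eval.
rewrite hamiltonian_field_mpoly//; apply/rowP=> k.
have /rowP/(_ k) := @modular_hierarchy _ N X half d dd dC dx natr_neq0 halfE P
  erefl erefl erefl P3 P4 PS j hj.
(* At [j = 1] the coefficient of the logarithm of the determinant vanishes. *)
have lenard_k : (j%:R - 1 : R) * point_eval x (sharp d (P j) (\det (flaschka_jacobi X)) 0 k) =
    (j%:R - 1) * (point_eval x (\det (flaschka_jacobi X))
      * point_eval x (sharp d (P j.-1) (jacobi_trace X 0) 0 k)).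
  case: j hj => [//|[_|i _]]; first by rewrite subrr !mul0r.
  have [L _] := @lenard_hierarchy _ N X half d dd dC dx natr_neq0 halfE P
    erefl erefl P3 P4 PS i.+1 isT.
  have /rowP/(_ k) := lenard_det dd natr_neq0 detN0 L.
  by rewrite mxZE => ->; rewrite rmorphM.
rewrite !(mxZE, mxDE) => /(congr1 (point_eval x)).
rewrite rmorphD !rmorphM rmorphB rmorph_nat rmorph1 => E.
have {lenard_k} F : (j%:R - 1 : R) / point_eval x (\det (flaschka_jacobi X))
      * point_eval x (sharp d (P j) (\det (flaschka_jacobi X)) 0 k)
    = (j%:R - 1) * point_eval x (sharp d (P j.-1) (jacobi_trace X 0) 0 k).
  by rewrite mulrAC lenard_k; field; rewrite lt0r_neq0.
apply: (mulfI (lt0r_neq0 pa0)).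
have mpE (v : 'rV[mpoly n R]_n) : map_mx (point_eval x) v 0 k = point_eval x (v 0 k).
  by rewrite mxE.
by rewrite !mpE F mulrDr mulVKf ?lt0r_neq0.
Qed.
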